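(* For $t\ge 0$ let $\varphi_t(z)=e^{-t}z+1-e^{-t}$ for $z\in\mathbb{D}$. A closed subspace $M$ of $H^2(\mathbb{D})$ is invariant under the Cesàro operator $\mathcal{C}$ if and only if its orthogonal complement $M^\perp$ in $H^2(\mathbb{D})$ is invariant under the semigroup of composition operators $\{C_{\varphi_t}\}_{t\ge 0}$, i.e. $C_{\varphi_t}M^\perp\subseteq M^\perp$ for every $t\ge 0$.
   Context: $\mathbb{D}$ is the open unit disc in $\mathbb{C}$ and $H^2(\mathbb{D})$ is the Hardy space with orthonormal basis $(z^n)_{n\ge 0}$. The Cesàro operator is the bounded operator on $H^2(\mathbb{D})$ given, for $f(z)=\sum_{k\ge0} a_k z^k$, by $\mathcal{C}f(z)=\sum_{n=0}^\infty\Big(\frac{1}{n+1}\sum_{k=0}^n a_k\Big)z^n$. For an analytic self-map $\varphi$ of $\mathbb{D}$, $C_\varphi f=f\circ\varphi$ is the composition operator; the operators $C_{\varphi_t}$ are bounded on $H^2(\mathbb{D})$ and form a $C_0$-semigroup. *)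

(* Defs.v *)
From Stdlib Require Import Reals Lra.
From Coquelicot Require Import Coquelicot.

Open Scope R_scope.

Definition unit_disc : Type := {z : C | Cmod z < 1}.

Definition disc_val (z : unit_disc) : C := proj1_sig z.
Coercion disc_val : unit_disc >-> C.

(* [iota] picks the unique element satisfying a predicate, so this is the sum
   of the series when it converges; it is unspecified otherwise. *)
Definition CSeries (u : nat -> C) : C :=
  @iota C_CompleteNormedModule (fun s => @is_series C_AbsRing C_NormedModule u s).

Definition has_coefs (f : unit_disc -> C) (a : nat -> C) : Prop :=
  forall z : unit_disc, @is_pseries C_AbsRing C_NormedModule a (z : C) (f z).

(* The n-th Taylor coefficient at 0; unspecified when f is not the sum of a
   power series on the disc. See [coef_eq]. *)
Definition coef (f : unit_disc -> C) (n : nat) : C :=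
  @iota C_CompleteNormedModule (fun c => exists a, has_coefs f a /\ a n = c).

(* The space H^2 is described through the orthonormal basis (z^n): it consists
   of the sums of power series with square-summable coefficients. *)
Definition H2 (f : unit_disc -> C) : Prop :=
  exists a : nat -> C,
    has_coefs f a /\ ex_series (fun n => Cmod (a n) ^ 2).

Definition inner (f g : unit_disc -> C) : C :=
  CSeries (fun n => Cmult (coef f n) (Cconj (coef g n))).

Definition H2norm (f : unit_disc -> C) : R := sqrt (Re (inner f f)).

Definition is_closed_subspace (M : (unit_disc -> C) -> Prop) : Prop :=
  (forall f, M f -> H2 f) /\
  M (fun _ => RtoC 0) /\
  (forall f g, M f -> M g -> M (fun z => Cplus (f z) (g z))) /\
  (forall (c : C) f, M f -> M (fun z => Cmult c (f z))) /\
  (forall f, H2 f ->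
     (forall eps : R, 0 < eps ->
        exists g, M g /\ H2norm (fun z => Cminus (f z) (g z)) < eps) ->
     M f).

Definition orthocompl (M : (unit_disc -> C) -> Prop) (g : unit_disc -> C) : Prop :=
  H2 g /\ forall f, M f -> inner f g = RtoC 0.

Definition invariant (M : (unit_disc -> C) -> Prop)
    (T : (unit_disc -> C) -> (unit_disc -> C)) : Prop :=
  forall f, M f -> M (T f).

(* [sum_n u n] is u 0 + ... + u n, and [INR (S n)] is n + 1. *)
Definition cesaro (f : unit_disc -> C) : unit_disc -> C :=
  fun z => CSeries (fun n =>
    Cmult (Cmult (RtoC (/ INR (S n))) (@sum_n C_AbelianMonoid (coef f) n))
          (Cpow (z : C) n)).

Definition comp_op (phi : unit_disc -> unit_disc) (f : unit_disc -> C) : unit_disc -> C :=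
  fun z => f (phi z).

Definition phi_val (t : R) (z : C) : C :=
  Cminus (Cplus (Cmult (RtoC (exp (- t))) z) (RtoC 1)) (RtoC (exp (- t))).

Lemma phi_val_disc (t : R) (ht : 0 <= t) (z : unit_disc) :
  Cmod (phi_val t (z : C)) < 1.
Proof.
  destruct z as [z hz]; unfold disc_val; simpl.
  pose proof (exp_pos (- t)) as h0.
  assert (h1 : exp (- t) <= 1).
  { rewrite <- exp_0. destruct ht as [ht | <-].
    - left; apply exp_increasing; lra.
    - rewrite Ropp_0; lra. }
  replace (phi_val t z)
    with (Cplus (Cmult (RtoC (exp (- t))) z) (RtoC (1 - exp (- t)))).
  2: { unfold phi_val; rewrite RtoC_minus; ring. }
  eapply Rle_lt_trans; [apply Cmod_triangle |].
  rewrite Cmod_mult, !Cmod_R, !Rabs_pos_eq by lra.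
  nra.
Qed.

Definition phi (t : R) (ht : 0 <= t) (z : unit_disc) : unit_disc :=
  exist _ (phi_val t (z : C)) (phi_val_disc t ht z).

Lemma CSeries_eq (u : nat -> C) (s : C) :
  @is_series C_AbsRing C_NormedModule u s -> CSeries u = s.
Proof.
  intros h. unfold CSeries.
  apply (@iota_filterlim_locally C_AbsRing C_CompleteNormedModule nat eventually).
  - apply Proper_StrongProper, eventually_filter.
  - exact h.
Qed.

Lemma is_series_Re_Im (u : nat -> C) (s : C) :
  @is_series C_AbsRing C_NormedModule u s ->
  is_series (fun n => Re (u n)) (Re s) /\ is_series (fun n => Im (u n)) (Im s).
Proof.
  intros h.
  assert (E : forall n,
    Re (@sum_n C_AbelianMonoid u n) = @sum_n R_AbelianMonoid (fun k => Re (u k)) n /\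
    Im (@sum_n C_AbelianMonoid u n) = @sum_n R_AbelianMonoid (fun k => Im (u k)) n).
  { induction n as [|n [IH1 IH2]].
    - now rewrite !sum_O.
    - rewrite !sum_Sn, <- IH1, <- IH2; split; reflexivity. }
  split; apply filterlim_locally; intros eps;
    generalize (proj1 (filterlim_locally (U := C_UniformSpace) _ _) h eps);
    apply filter_imp; intros n [h1 h2].
  - change (ball (Re s) eps (@sum_n R_AbelianMonoid (fun k => Re (u k)) n)).
    rewrite <- (proj1 (E n)); exact h1.
  - change (ball (Im s) eps (@sum_n R_AbelianMonoid (fun k => Im (u k)) n)).
    rewrite <- (proj2 (E n)); exact h2.
Qed.

Lemma has_coefs_unique (f : unit_disc -> C) (a b : nat -> C) :
  has_coefs f a -> has_coefs f b -> forall n, a n = b n.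
Proof.
  intros ha hb.
  assert (P : forall c, has_coefs f c -> forall (x : R) (hx : Cmod (RtoC x) < 1),
    is_pseries (fun n => Re (c n)) x (Re (f (exist _ (RtoC x) hx))) /\
    is_pseries (fun n => Im (c n)) x (Im (f (exist _ (RtoC x) hx)))).
  { intros c hc x hx.
    destruct (is_series_Re_Im _ _ (hc (exist _ (RtoC x) hx))) as [h1 h2].
    assert (E : forall n, @pow_n C_AbsRing (RtoC x) n = RtoC (@pow_n R_AbsRing x n)).
    { induction n as [|n IH]; [reflexivity|].
      simpl pow_n. rewrite IH. change (Cmult (RtoC x) (RtoC (pow_n x n)) = RtoC (x * pow_n x n)).
      now rewrite RtoC_mult. }
    split; [revert h1 | revert h2]; apply is_series_ext; intros n;
      change (disc_val (exist _ (RtoC x) hx)) with (RtoC x); rewrite E;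
      destruct (c n) as [p q];
      unfold scal, Re, Im; simpl; unfold mult; simpl; ring. }
  assert (CV : forall c : nat -> R,
    (forall x, Rabs x < 1 -> ex_pseries c x) -> Rbar_lt 0 (CV_radius c)).
  { intros c hc. apply Rbar_lt_le_trans with (Finite (1/2)); [simpl; lra|].
    apply Rbar_not_lt_le; intros hlt.
    apply (CV_disk_outside c (1/2)); [rewrite Rabs_pos_eq by lra; exact hlt|].
    assert (hh : ex_pseries c (1/2)) by (apply hc; rewrite Rabs_pos_eq; lra).
    destruct hh as [l hl].
    apply is_pseries_R in hl.
    apply ex_series_lim_0; now exists l. }
  assert (H1 : forall x : R, Rabs x < 1 -> Cmod (RtoC x) < 1).
  { intros x hx; now rewrite Cmod_R. }
  assert (NB : locally 0 (fun x => Rabs x < 1)).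
  { exists (mkposreal 1 Rlt_0_1); intros y hy.
    unfold ball in hy; simpl in hy; unfold AbsRing_ball, abs, minus, plus, opp in hy;
      simpl in hy. now rewrite Ropp_0, Rplus_0_r in hy. }
  intros n.
  assert (HR : Re (a n) = Re (b n)).
  { apply (PSeries_ext_recip (fun n => Re (a n)) (fun n => Re (b n)) n).
    - apply CV; intros x hx; eexists; apply (P a ha x (H1 x hx)).
    - apply CV; intros x hx; eexists; apply (P b hb x (H1 x hx)).
    - revert NB; apply filter_imp; intros x hx.
      rewrite (is_pseries_unique _ _ _ (proj1 (P a ha x (H1 x hx)))).
      now rewrite (is_pseries_unique _ _ _ (proj1 (P b hb x (H1 x hx)))). }
  assert (HI : Im (a n) = Im (b n)).
  { apply (PSeries_ext_recip (fun n => Im (a n)) (fun n => Im (b n)) n).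
    - apply CV; intros x hx; eexists; apply (P a ha x (H1 x hx)).
    - apply CV; intros x hx; eexists; apply (P b hb x (H1 x hx)).
    - revert NB; apply filter_imp; intros x hx.
      rewrite (is_pseries_unique _ _ _ (proj2 (P a ha x (H1 x hx)))).
      now rewrite (is_pseries_unique _ _ _ (proj2 (P b hb x (H1 x hx)))). }
  now apply injective_projections.
Qed.

Lemma coef_eq (f : unit_disc -> C) (a : nat -> C) :
  has_coefs f a -> forall n, coef f n = a n.
Proof.
  intros h n. unfold coef.
  apply (@iota_unique C_AbsRing C_CompleteNormedModule).
  - intros c [b [hb <-]]. exact (has_coefs_unique f b a hb h n).
  - now exists a.
Qed.

(* Main.v *)
(* On Taylor coefficients the adjoint of [C_phi_t] is the lower triangular matrix
   [S_r = (C(n,k) r^k (1-r)^(n-k))], [r = exp (- t)].  It and the Cesaro operator are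
   Hausdorff matrices: in the basis of the sequences [n |-> C(n,k)] they are diagonal,
   with entries [r^k] and [1/(k+1)].  So [S] is the semigroup generated by
   [(G x)_n = - n (x_n - x_(n-1))] and the Cesaro operator is [(1 - G)^-1].

   Since [M] is closed, it equals its double orthogonal complement, so the claim is that [M]
   is invariant under the Cesaro operator iff it is invariant under all [S_r].  Summation by
   parts gives [Re <G x, x> <= |x|^2 / 2], also for truncated sums, hence bounds on the
   resolvents of [G]; convexity gives [|S_r x|^2 <= |x|^2 / r].

   If the Cesaro operator [K] preserves [M] and [x = (1 - h G)^-1 f] with [f] in [M], then
   [h x = K (f - (1 - h) x)], so the component [q] of [x] orthogonal to [M] satisfies
   [h |q|^2 = - (1 - h) Re <K q, q> <= 0], whence [x] is in [M]; the backward Euler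
   iterates [(1 - (t/n) G)^-n f] converge weakly to [S_r f].  Conversely, the Abel means
   [y = (1 - r) sum_j r^j S_r^j f] satisfy [y = (1 - r) f + r S_r y], which puts them in [M]
   in the same way, and they converge weakly to [K f] as [r] tends to [1]. *)
Require Import Defs.
From Stdlib Require Import Reals Lra Lia ClassicalEpsilon FunctionalExtensionality.
From Coquelicot Require Import Coquelicot.
Open Scope R_scope.

(** * Square-summable sequences *)

Definition dot (z w : C) : R := Re z * Re w + Im z * Im w.

Definition vzero : nat -> C := fun _ => RtoC 0.
Definition vadd (a b : nat -> C) : nat -> C := fun n => Cplus (a n) (b n).
Definition vscale (c : C) (a : nat -> C) : nat -> C := fun n => Cmult c (a n).
Definition vsub (a b : nat -> C) : nat -> C := vadd a (vscale (RtoC (-1)) b).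

(* A real inner product is enough: the complex one is recovered as
   [<a,b> = ip a b + i ip a (i b)]; see [cinner]. *)
Definition psum (a b : nat -> C) (N : nat) : R :=
  @sum_n R_AbelianMonoid (fun n => dot (a n) (b n)) N.
Definition ip (a b : nat -> C) : R := real (Lim_seq (psum a b)).
Definition l2 (a : nat -> C) : Prop := exists B, forall N, psum a a N <= B.

Ltac vext := apply functional_extensionality; intros ?;
  unfold vsub, vadd, vscale, vzero; apply injective_projections; simpl; try ring.

Lemma psum_O a b : psum a b 0 = dot (a O) (b O).
Proof. unfold psum; now rewrite sum_O. Qed.

Lemma psum_S a b N : psum a b (S N) = psum a b N + dot (a (S N)) (b (S N)).
Proof. unfold psum; now rewrite sum_Sn. Qed.

Lemma psum_le a b c d N :
  (forall n, (n <= N)%nat -> dot (a n) (b n) <= dot (c n) (d n)) ->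
  psum a b N <= psum c d N.
Proof.
  induction N as [|N IH]; intros h.
  - rewrite !psum_O; apply h; lia.
  - rewrite !psum_S; specialize (h (S N) (le_n _)) as h'.
    assert (psum a b N <= psum c d N) by (apply IH; intros; apply h; lia). lra.
Qed.

Lemma psum_sym a b N : psum a b N = psum b a N.
Proof. apply Rle_antisym; apply psum_le; intros; unfold dot; lra. Qed.

Lemma psum_add_l a b c N : psum (vadd a b) c N = psum a c N + psum b c N.
Proof.
  induction N as [|N IH]; [rewrite !psum_O | rewrite !psum_S, IH];
    unfold dot, vadd, Re, Im; simpl; ring.
Qed.

Lemma psum_scale_l r a c N : psum (vscale (RtoC r) a) c N = r * psum a c N.
Proof.
  induction N as [|N IH]; [rewrite !psum_O | rewrite !psum_S, IH];
    unfold dot, vscale, Re, Im; simpl; ring.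
Qed.

Lemma psum_Ci a c N : psum (vscale Ci a) c N = - psum a (vscale Ci c) N.
Proof.
  induction N as [|N IH]; [rewrite !psum_O | rewrite !psum_S, IH];
    unfold dot, vscale, Re, Im; simpl; ring.
Qed.

Lemma psum_add_r a b c N : psum c (vadd a b) N = psum c a N + psum c b N.
Proof. now rewrite psum_sym, psum_add_l, !(psum_sym c). Qed.

Lemma psum_scale_r r a c N : psum c (vscale (RtoC r) a) N = r * psum c a N.
Proof. now rewrite psum_sym, psum_scale_l, (psum_sym c). Qed.

Ltac psum_expand := unfold vsub;
  rewrite ?psum_add_l, ?psum_add_r, ?psum_scale_l, ?psum_scale_r,
    ?psum_add_l, ?psum_add_r, ?psum_scale_l, ?psum_scale_r,
    ?psum_add_l, ?psum_add_r, ?psum_scale_l, ?psum_scale_r.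

Lemma dot_pos z : 0 <= dot z z.
Proof. unfold dot; nra. Qed.

Lemma psum_pos a N : 0 <= psum a a N.
Proof.
  induction N as [|N IH]; [rewrite psum_O; apply dot_pos | rewrite psum_S].
  pose proof (dot_pos (a (S N))); lra.
Qed.

Lemma psum_mono a n N : (n <= N)%nat -> psum a a n <= psum a a N.
Proof.
  induction 1 as [|N _ IH]; [lra|].
  rewrite psum_S; pose proof (dot_pos (a (S N))); lra.
Qed.

Lemma dot_le_psum a N : dot (a N) (a N) <= psum a a N.
Proof.
  destruct N; [rewrite psum_O | rewrite psum_S; pose proof (psum_pos a N)]; lra.
Qed.

Lemma psum_add_sq a b N :
  psum (vadd a b) (vadd a b) N <= 2 * psum a a N + 2 * psum b b N.
Proof.
  pose proof (psum_pos (vsub a b) N) as h; revert h.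
  psum_expand; rewrite (psum_sym b a); lra.
Qed.

(** Expanding [0 <= |b - k x|^2] gives [|b|^2 >= 2 k <b,x> - k^2 |x|^2], and the hypothesis bounds
    the cross term. This turns coercivity into a norm bound for the solution [x] of a linear
    equation with datum [b]. *)
Lemma psum_coercive k b x N :
  k * psum x x N <= psum b x N -> 0 <= k -> k ^ 2 * psum x x N <= psum b b N.
Proof.
  intros h hk.
  pose proof (psum_pos (vsub b (vscale (RtoC k) x)) N) as h'; revert h'.
  psum_expand; rewrite (psum_sym x b); nra.
Qed.

Lemma l2_zero : l2 vzero.
Proof.
  exists 0; induction N as [|N IH]; [rewrite psum_O | rewrite psum_S];
    unfold dot, vzero, Re, Im in *; simpl in *; lra.
Qed.

Lemma l2_add a b : l2 a -> l2 b -> l2 (vadd a b).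
Proof.
  intros [A hA] [B hB]; exists (2 * A + 2 * B); intros N.
  pose proof (psum_add_sq a b N); specialize (hA N); specialize (hB N); lra.
Qed.

Lemma psum_scale_sq c a N :
  psum (vscale c a) (vscale c a) N = dot c c * psum a a N.
Proof.
  induction N as [|N IH]; [rewrite !psum_O | rewrite !psum_S, IH];
    unfold dot, vscale, Re, Im; simpl; ring.
Qed.

Lemma l2_scale c a : l2 a -> l2 (vscale c a).
Proof.
  intros [A hA]; exists (dot c c * A); intros N; rewrite psum_scale_sq.
  apply Rmult_le_compat_l; [apply dot_pos | apply hA].
Qed.

Lemma l2_sub a b : l2 a -> l2 b -> l2 (vsub a b).
Proof. intros; apply l2_add; [|apply l2_scale]; assumption. Qed.

Lemma ip_unique a b (l : R) : is_lim_seq (psum a b) l -> ip a b = l.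
Proof. intros h; unfold ip; now rewrite (is_lim_seq_unique _ _ h). Qed.

(** The diagonal sums are increasing and bounded; polarization reduces the mixed sum to three of
    them. *)
Lemma is_lim_ip a b : l2 a -> l2 b -> is_lim_seq (psum a b) (ip a b).
Proof.
  assert (H : forall c, l2 c -> ex_finite_lim_seq (psum c c)).
  { intros c [B hB]; apply ex_finite_lim_seq_incr with B; [|exact hB].
    intros n; apply psum_mono; lia. }
  intros ha hb; apply Lim_seq_correct'.
  destruct (H _ ha) as [la ha']; destruct (H _ hb) as [lb hb'];
    destruct (H _ (l2_add _ _ ha hb)) as [lc hc'].
  exists (/2 * (lc - la - lb)).
  apply is_lim_seq_ext with
    (fun N => / 2 * (psum (vadd a b) (vadd a b) N - psum a a N - psum b b N)).
  { intros N; psum_expand; rewrite (psum_sym b a); lra. }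
  apply (is_lim_seq_scal_l _ (/2) (lc - la - lb)).
  apply is_lim_seq_minus'; [apply is_lim_seq_minus'|]; assumption.
Qed.

Lemma ip_sym a b : ip a b = ip b a.
Proof. unfold ip; f_equal; apply Lim_seq_ext; intros; apply psum_sym. Qed.

Lemma ip_add_l a b c : l2 a -> l2 b -> l2 c -> ip (vadd a b) c = ip a c + ip b c.
Proof.
  intros; apply ip_unique.
  apply is_lim_seq_ext with (fun N => psum a c N + psum b c N);
    [intros; now rewrite psum_add_l|].
  apply is_lim_seq_plus'; apply is_lim_ip; assumption.
Qed.

Lemma ip_scale_l r a c : l2 a -> l2 c -> ip (vscale (RtoC r) a) c = r * ip a c.
Proof.
  intros; apply ip_unique.
  apply is_lim_seq_ext with (fun N => r * psum a c N);
    [intros; now rewrite psum_scale_l|].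
  apply (is_lim_seq_scal_l _ r (ip a c)); apply is_lim_ip; assumption.
Qed.

Lemma ip_Ci a c : l2 a -> l2 c -> ip (vscale Ci a) c = - ip a (vscale Ci c).
Proof.
  intros; apply ip_unique.
  apply is_lim_seq_ext with (fun N => - psum a (vscale Ci c) N);
    [intros; now rewrite psum_Ci|].
  apply (is_lim_seq_opp _ (ip a (vscale Ci c))); apply is_lim_ip;
    [assumption | now apply l2_scale].
Qed.

Lemma ip_add_r a b c : l2 a -> l2 b -> l2 c -> ip c (vadd a b) = ip c a + ip c b.
Proof. intros; now rewrite ip_sym, ip_add_l, !(ip_sym c). Qed.

Lemma ip_scale_r r a c : l2 a -> l2 c -> ip c (vscale (RtoC r) a) = r * ip c a.
Proof. intros; now rewrite ip_sym, ip_scale_l, (ip_sym c). Qed.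

Create HintDb l2 discriminated.
#[local] Hint Resolve l2_zero l2_add l2_scale l2_sub : l2.

Ltac ip_expand := unfold vsub;
  repeat (first [rewrite ip_add_l | rewrite ip_add_r | rewrite ip_scale_l
                | rewrite ip_scale_r]; [| now auto 10 with l2 ..]).

Lemma psum_le_ip a N : l2 a -> psum a a N <= ip a a.
Proof.
  intros ha.
  apply (is_lim_seq_incr_compare (psum a a)); [now apply is_lim_ip|].
  intros n; apply psum_mono; lia.
Qed.

Lemma ip_le a b c d k : l2 a -> l2 b -> l2 c -> l2 d ->
  (forall N, psum a b N <= k * psum c d N) -> ip a b <= k * ip c d.
Proof.
  intros ha hb hc hd h.
  apply (is_lim_seq_le (psum a b) (fun N => k * psum c d N) (ip a b) (k * ip c d) h).
  - now apply is_lim_ip.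
  - apply (is_lim_seq_scal_l _ k (ip c d)); now apply is_lim_ip.
Qed.

Lemma ip_le_bound a B : (forall N, psum a a N <= B) -> ip a a <= B.
Proof.
  intros h.
  apply (is_lim_seq_le (psum a a) (fun _ => B) (ip a a) B h).
  - apply is_lim_ip; now exists B.
  - apply is_lim_seq_const.
Qed.

Lemma ip_pos a : l2 a -> 0 <= ip a a.
Proof. intros ha; apply Rle_trans with (psum a a 0); [apply psum_pos | now apply psum_le_ip]. Qed.

Lemma ip_zero_eq a : l2 a -> ip a a <= 0 -> a = vzero.
Proof.
  intros ha h; apply functional_extensionality; intros n.
  pose proof (dot_le_psum a n); pose proof (psum_le_ip a n ha).
  pose proof (dot_pos (a n)).
  assert (E : dot (a n) (a n) = 0) by lra.
  unfold dot in E; apply injective_projections; unfold Re, Im in E; simpl; nra.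
Qed.

Lemma ip_cauchy_schwarz a b : l2 a -> l2 b -> ip a b ^ 2 <= ip a a * ip b b.
Proof.
  intros ha hb.
  pose proof (ip_pos _ ha) as pa; pose proof (ip_pos _ hb) as pb.
  assert (H : forall t, 0 <= ip a a + 2 * t * ip a b + t ^ 2 * ip b b).
  { intros t; pose proof (ip_pos (vadd a (vscale (RtoC t) b)) ltac:(auto with l2)) as h.
    revert h; ip_expand; rewrite (ip_sym b a); lra. }
  destruct (Req_dec (ip b b) 0) as [e|ne].
  - rewrite (ip_zero_eq b hb) by lra.
    assert (E : ip a vzero = 0).
    { replace vzero with (vscale (RtoC 0) a) by vext.
      rewrite ip_scale_r by auto with l2; ring. }
    rewrite E; replace (ip vzero vzero) with 0; [lra|].
    symmetry; replace vzero with (vscale (RtoC 0) a) at 1 by vext.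
    rewrite ip_scale_l by auto with l2; ring.
  - specialize (H (- ip a b / ip b b)).
    apply Rmult_le_compat_l with (r := ip b b) in H; [|lra].
    field_simplify in H; [|lra..]. nra.
Qed.

(** * Closed subspaces and adjoints *)

Definition closed_sub (L : (nat -> C) -> Prop) : Prop :=
  (forall a, L a -> l2 a) /\ L vzero /\
  (forall a b, L a -> L b -> L (vadd a b)) /\
  (forall c a, L a -> L (vscale c a)) /\
  (forall x, l2 x ->
     (forall eps, 0 < eps -> exists p, L p /\ ip (vsub x p) (vsub x p) < eps) -> L x).

Lemma closed_sub_l2 L a : closed_sub L -> L a -> l2 a.
Proof. intros hL; apply hL. Qed.

Lemma closed_sub_scale L c a : closed_sub L -> L a -> L (vscale c a).
Proof. intros (_ & _ & _ & h & _); apply h. Qed.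

(** For sequences bounded in norm, coordinatewise convergence amounts to weak convergence in l^2. *)
Definition cvg (u : nat -> nat -> C) (x : nat -> C) : Prop :=
  forall n, is_lim_seq (fun j => Re (u j n)) (Re (x n)) /\
            is_lim_seq (fun j => Im (u j n)) (Im (x n)).

Lemma cvg_const x : cvg (fun _ => x) x.
Proof. intros n; split; apply is_lim_seq_const. Qed.

Lemma cvg_sub u x v y : cvg u x -> cvg v y -> cvg (fun j => vsub (u j) (v j)) (vsub x y).
Proof.
  intros hu hv n; destruct (hu n) as [h1 h2], (hv n) as [h3 h4].
  split.
  - replace (Re (vsub x y n)) with (Re (x n) - Re (y n))
      by (unfold vsub, vadd, vscale, Re; simpl; ring).
    apply is_lim_seq_ext with (fun j => Re (u j n) - Re (v j n));
      [|now apply is_lim_seq_minus'].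
    intros j; unfold vsub, vadd, vscale, Re; simpl; ring.
  - replace (Im (vsub x y n)) with (Im (x n) - Im (y n))
      by (unfold vsub, vadd, vscale, Im; simpl; ring).
    apply is_lim_seq_ext with (fun j => Im (u j n) - Im (v j n));
      [|now apply is_lim_seq_minus'].
    intros j; unfold vsub, vadd, vscale, Im; simpl; ring.
Qed.

Lemma cvg_psum u x v y N : cvg u x -> cvg v y ->
  is_lim_seq (fun j => psum (u j) (v j) N) (psum x y N).
Proof.
  intros hu hv.
  assert (H : forall n, is_lim_seq (fun j => dot (u j n) (v j n)) (dot (x n) (y n))).
  { intros n; destruct (hu n), (hv n); apply is_lim_seq_plus';
      now apply is_lim_seq_mult'. }
  induction N as [|N IH].
  - rewrite psum_O; apply is_lim_seq_ext with (2 := H O); intros; now rewrite psum_O.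
  - rewrite psum_S; apply is_lim_seq_ext with (2 := is_lim_seq_plus' _ _ _ _ IH (H (S N))).
    intros; now rewrite psum_S.
Qed.

(** A Fatou argument: a truncated sum has finitely many terms, so it passes to the limit together
    with its bound. *)
Lemma cvg_psum_le u x B (b : R) N : cvg u x -> is_lim_seq B b ->
  (exists J, forall j, (J <= j)%nat -> psum (u j) (u j) N <= B j) -> psum x x N <= b.
Proof.
  intros hu hB [J h].
  apply (is_lim_seq_le (fun j => psum (u (j + J)%nat) (u (j + J)%nat) N) (fun j => B (j + J)%nat)
           (psum x x N) b).
  - intros j; apply h; lia.
  - apply (is_lim_seq_incr_n (fun j => psum (u j) (u j) N)); now apply cvg_psum.
  - now apply (is_lim_seq_incr_n B).
Qed.

Lemma is_lim_seq_inv_S : is_lim_seq (fun j => / INR (S j)) 0.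
Proof.
  apply (is_lim_seq_incr_1 (fun j => / INR j)).
  replace (Finite 0) with (Rbar_inv p_infty) by reflexivity.
  apply is_lim_seq_inv; [apply is_lim_seq_INR | easy].
Qed.

Lemma cauchy_cvg (u : nat -> R) (e : nat -> R) : is_lim_seq e 0 ->
  (forall i j, (u i - u j) ^ 2 <= e i + e j) -> ex_finite_lim_seq u.
Proof.
  intros he h; apply ex_lim_seq_cauchy_corr; intros eps.
  assert (hp : 0 < eps ^ 2 / 2) by (pose proof (cond_pos eps); nra).
  apply is_lim_seq_spec in he; destruct (he (mkposreal _ hp)) as [N hN]; simpl in hN.
  exists N; intros n m hn hm.
  pose proof (h n m) as h1; pose proof (hN n hn) as h2; pose proof (hN m hm) as h3.
  apply Rabs_def2 in h2; apply Rabs_def2 in h3.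
  pose proof (cond_pos eps).
  apply Rabs_def1; nra.
Qed.

(** * Orthogonal projection onto a closed subspace *)

Lemma minimizing_sequence L x : closed_sub L -> l2 x ->
  exists (d : R) (p : nat -> nat -> C), (forall j, L (p j)) /\
    (forall a, L a -> d <= ip (vsub x a) (vsub x a)) /\
    (forall j, ip (vsub x (p j)) (vsub x (p j)) < d + / INR (S j)).
Proof.
  intros (Ll2 & L0 & Ladd & Lscale & Lcl) hx.
  (* [completeness] yields suprema, so the infimum of the squared distances is minus the supremum of
     their opposites. *)
  destruct (completeness (fun y => exists a, L a /\ y = - ip (vsub x a) (vsub x a)))
    as [m [hub hleast]].
  - exists 0; intros y (a & ha & ->).
    pose proof (ip_pos (vsub x a) ltac:(auto with l2)); lra.
  - exists (- ip (vsub x vzero) (vsub x vzero)), vzero; split; [exact L0 | reflexivity].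
  - assert (hp : forall j : nat, exists p, L p /\
               ip (vsub x p) (vsub x p) < - m + / INR (S j)).
    { intros j; apply NNPP; intros hn.
      assert (pj : 0 < / INR (S j)) by (apply Rinv_0_lt_compat, lt_0_INR; lia).
      assert (m <= m - / INR (S j)); [|lra].
      apply hleast; intros y (a & ha & ->).
      apply Rnot_lt_le; intros hlt; apply hn; exists a; split; [exact ha | lra]. }
    exists (- m), (fun j => proj1_sig (constructive_indefinite_description _ (hp j))).
    split; [|split].
    + intros j; now destruct (constructive_indefinite_description _ (hp j)) as [p [h1 h2]].
    + intros a ha.
      assert (- ip (vsub x a) (vsub x a) <= m) by (apply hub; now exists a). lra.
    + intros j; now destruct (constructive_indefinite_description _ (hp j)) as [p [h1 h2]].
Qed.

Lemma orthogonal_decomposition L x : closed_sub L -> l2 x ->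
  exists p q, L p /\ l2 q /\ (forall a, L a -> ip a q = 0) /\ x = vadd p q.
Proof.
  intros hL hx.
  destruct (minimizing_sequence L x hL hx) as (d & p & hp & hd & hm).
  destruct hL as (Ll2 & L0 & Ladd & Lscale & Lcl).
  set (e := fun j => / INR (S j)) in *.
  assert (pl2 : forall j, l2 (p j)) by auto.
  (* parallelogram law *)
  assert (hc : forall i j, ip (vsub (p i) (p j)) (vsub (p i) (p j)) <= 2 * (e i + e j)).
  { intros i j.
    pose proof (hm i) as h1; pose proof (hm j) as h2.
    pose proof (hd (vscale (RtoC (/2)) (vadd (p i) (p j))) ltac:(auto)) as h3.
    revert h1 h2 h3; pose proof (pl2 i); pose proof (pl2 j).
    ip_expand; rewrite !(ip_sym (p _) x), (ip_sym (p j) (p i)); unfold e; lra. }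
  assert (he : is_lim_seq (fun j => 2 * e j) 0).
  { replace (Finite 0) with (Rbar_mult 2 0) by (simpl; f_equal; ring).
    apply is_lim_seq_scal_l, is_lim_seq_inv_S. }
  assert (hcn : forall i j n, dot (vsub (p i) (p j) n) (vsub (p i) (p j) n)
                              <= 2 * e i + 2 * e j).
  { intros i j n.
    eapply Rle_trans; [apply dot_le_psum|].
    eapply Rle_trans; [apply psum_le_ip; auto with l2|].
    specialize (hc i j); lra. }
  pose (x0 := fun n => ((real (Lim_seq (fun j => Re (p j n))),
                         real (Lim_seq (fun j => Im (p j n)))) : C)).
  assert (hcv : cvg p x0).
  { intros n; split; apply Lim_seq_correct', cauchy_cvg with (1 := he);
      intros i j; specialize (hcn i j n); revert hcn;
      pose proof (Rle_0_sqr (fst (p i n) - fst (p j n)));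
      pose proof (Rle_0_sqr (snd (p i n) - snd (p j n)));
      unfold Rsqr, dot, vsub, vadd, vscale, Re, Im in *; simpl; lra. }
  (* Letting [j] tend to infinity in [hc] upgrades the coordinatewise limit [x0] to a limit in
     norm. *)
  assert (hb : forall i N, psum (vsub (p i) x0) (vsub (p i) x0) N <= 2 * e i).
  { intros i N.
    apply cvg_psum_le with (u := fun j => vsub (p i) (p j)) (B := fun j => 2 * e i + 2 * e j).
    - apply cvg_sub; [apply cvg_const | exact hcv].
    - replace (2 * e i) with (2 * e i + 0) at 1 by ring.
      apply is_lim_seq_plus'; [apply is_lim_seq_const | exact he].
    - exists O; intros j _; eapply Rle_trans; [apply psum_le_ip; auto with l2|].
      specialize (hc i j); lra. }
  assert (hx0 : l2 x0).
  { replace x0 with (vsub (p O) (vsub (p O) x0)) by vext.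
    apply l2_sub; [auto|]; exists (2 * e O); apply hb. }
  assert (Lx0 : L x0).
  { apply Lcl; [exact hx0|]; intros eps heps.
    apply is_lim_seq_spec in he; destruct (he (mkposreal _ heps)) as [N hN].
    exists (p N); split; [apply hp|].
    specialize (hN N (le_n _)); simpl in hN; apply Rabs_def2 in hN.
    apply Rle_lt_trans with (2 * e N); [|lra].
    apply ip_le_bound; intros n; specialize (hb N n); revert hb.
    psum_expand; rewrite (psum_sym x0 (p N)); lra. }
  assert (hq : ip (vsub x x0) (vsub x x0) <= d).
  { apply ip_le_bound; intros N.
    apply cvg_psum_le with (u := fun j => vsub x (p j)) (B := fun j => d + e j).
    - apply cvg_sub; [apply cvg_const | exact hcv].
    - replace d with (d + 0) at 1 by ring.
      apply is_lim_seq_plus'; [apply is_lim_seq_const | apply is_lim_seq_inv_S].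
    - exists O; intros j _; eapply Rle_trans; [apply psum_le_ip; auto with l2|].
      left; apply hm. }
  exists x0, (vsub x x0); split; [exact Lx0|]; split; [auto with l2|]; split; [|vext].
  intros a ha.
  pose proof (Ll2 a ha) as al2; pose proof (ip_pos a al2) as pa.
  set (c := ip a (vsub x x0)).
  (* The optimal step is [c / ip a a]; the added 1 avoids a zero denominator, and the quadratic
     below is still negative unless [c = 0]. *)
  set (t := c / (1 + ip a a)).
  pose proof (hd (vadd x0 (vscale (RtoC t) a)) ltac:(auto)) as h.
  replace (vsub x (vadd x0 (vscale (RtoC t) a)))
    with (vsub (vsub x x0) (vscale (RtoC t) a)) in h by vext.
  assert (h' : 0 <= - 2 * t * c + t ^ 2 * ip a a).
  { set (q := vsub x x0) in *; assert (l2 q) by (unfold q; auto with l2).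
    clearbody q; revert h; ip_expand; rewrite (ip_sym q a); fold c; nra. }
  unfold t in h'; clearbody c; clear - h' pa.
  assert (E : c = (c / (1 + ip a a)) * (1 + ip a a)) by (field; lra).
  set (s := c / (1 + ip a a)) in *; rewrite E in h' |- *.
  assert (s * s <= 0) by nra. assert (s = 0) by nra. rewrite H0; ring.
Qed.

(** * Tails and weak limits *)

Definition tail (K : nat) (a : nat -> C) : nat -> C :=
  fun n => if Nat.leb n K then RtoC 0 else a n.

Lemma psum_tail u a K N : (K <= N)%nat -> psum u (tail K a) N = psum u a N - psum u a K.
Proof.
  induction 1 as [|N h IH].
  - enough (H : forall n, (n <= K)%nat -> psum u (tail K a) n = 0) by (rewrite H; lia || lra).
    induction n as [|n IH]; intros hn; [rewrite psum_O | rewrite psum_S, IH by lia];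
      unfold tail, dot, Re, Im; rewrite (proj2 (Nat.leb_le _ _)) by lia; simpl; ring.
  - rewrite !psum_S, IH; unfold tail at 1.
    rewrite (proj2 (Nat.leb_gt _ _)) by lia; ring.
Qed.

Lemma l2_tail K a : l2 a -> l2 (tail K a).
Proof.
  intros [B hB]; exists B; intros N; eapply Rle_trans; [|apply hB].
  apply psum_le; intros n _; unfold tail; destruct (Nat.leb n K); [|lra].
  pose proof (dot_pos (a n)); unfold dot at 1, Re, Im; simpl; lra.
Qed.
#[local] Hint Resolve l2_tail : l2.

Lemma ip_tail u a K : l2 u -> l2 a -> ip u (tail K a) = ip u a - psum u a K.
Proof.
  intros hu ha; apply ip_unique.
  apply is_lim_seq_ext_loc with (fun N => psum u a N - psum u a K).
  - exists K; intros; now rewrite psum_tail.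
  - apply is_lim_seq_minus'; [now apply is_lim_ip | apply is_lim_seq_const].
Qed.

Lemma tail_lim a : l2 a -> is_lim_seq (fun K => ip (tail K a) (tail K a)) 0.
Proof.
  intros ha; apply is_lim_seq_ext with (fun K => ip a a - psum a a K).
  - intros K; rewrite ip_tail, (ip_sym (tail K a)), ip_tail, (psum_sym (tail K a)) by auto with l2.
    rewrite psum_tail by lia; ring.
  - replace (Finite 0) with (Finite (ip a a - ip a a)) by (f_equal; ring).
    apply is_lim_seq_minus'; [apply is_lim_seq_const | now apply is_lim_ip].
Qed.

Lemma ip_zero_of_sq_le (c A : R) (a : nat -> C) : l2 a ->
  (forall K, c ^ 2 <= A * ip (tail K a) (tail K a)) -> c = 0.
Proof.
  intros ha h.
  assert (c ^ 2 <= 0); [|nra].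
  apply (is_lim_seq_le (fun _ => c ^ 2) (fun K => A * ip (tail K a) (tail K a)) (c ^ 2) 0 h).
  - apply is_lim_seq_const.
  - replace (Finite 0) with (Rbar_mult A 0) by (simpl; f_equal; ring).
    apply is_lim_seq_scal_l; now apply tail_lim.
Qed.

(** The pairing of [x - u j] with [q] is split at index [K]. The head tends to 0 with [j]; by
    Cauchy-Schwarz the square of the rest is at most [A] times the squared norm of [tail K q],
    uniformly in [j], and this vanishes as [K] grows. *)
Lemma orthogonal_weak_limit q u x B : l2 q -> l2 x ->
  (exists J, forall j, (J <= j)%nat ->
     l2 (u j) /\ ip (u j) q = 0 /\ forall N, psum (u j) (u j) N <= B) ->
  cvg u x -> ip x q = 0.
Proof.
  intros hq hx [J h] hc.
  set (A := 2 * ip x x + 2 * B).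
  apply (ip_zero_of_sq_le _ A q hq); intros K.
  apply (is_lim_seq_le (fun j => (ip x q - psum (vsub x (u (j + J)%nat)) q K) ^ 2)
           (fun _ => A * ip (tail K q) (tail K q)) (ip x q ^ 2)
           (A * ip (tail K q) (tail K q))).
  - intros j; destruct (h (j + J)%nat ltac:(lia)) as (h1 & h2 & h3).
    set (v := u (j + J)%nat) in *.
    assert (E : ip x q = ip (vsub x v) q) by (ip_expand; lra).
    rewrite E, <- ip_tail by auto with l2.
    eapply Rle_trans; [apply ip_cauchy_schwarz; auto with l2|].
    apply Rmult_le_compat_r; [apply ip_pos; auto with l2|].
    apply ip_le_bound; intros N; unfold vsub.
    eapply Rle_trans; [apply psum_add_sq|].
    rewrite psum_scale_l, psum_scale_r; unfold A.
    pose proof (psum_le_ip x N hx); specialize (h3 N); lra.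
  - assert (H : is_lim_seq (fun j => ip x q - psum (vsub x (u j)) q K) (ip x q)).
    { assert (Z : psum (vsub x x) q K = 0) by (psum_expand; ring).
      replace (Finite (ip x q)) with (Finite (ip x q - psum (vsub x x) q K))
        by (rewrite Z; f_equal; ring).
      apply is_lim_seq_minus'; [apply is_lim_seq_const|].
      apply cvg_psum; [|apply cvg_const]; apply cvg_sub; [apply cvg_const | exact hc]. }
    apply (is_lim_seq_incr_n _ J) in H.
    (* A square unfolds to [y * (y * 1)], hence the constant factor. *)
    apply is_lim_seq_ext with (2 := is_lim_seq_mult' _ _ _ _ H (is_lim_seq_mult' _ _ _ _ H
      (is_lim_seq_const 1))); reflexivity.
  - apply is_lim_seq_const.
Qed.

(** The component [q] of the limit orthogonal to [L] pairs to zero with each late [u j], hence with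
    the limit itself, so [<q,q> = 0]. *)
Lemma closed_sub_weak L u x B : closed_sub L ->
  (exists J, forall j, (J <= j)%nat -> L (u j) /\ forall N, psum (u j) (u j) N <= B) ->
  cvg u x -> L x.
Proof.
  intros hL [J h] hc.
  assert (hx : l2 x).
  { exists B; intros N; apply cvg_psum_le with (u := u) (B := fun _ => B); [exact hc| |].
    - apply is_lim_seq_const.
    - exists J; intros j hj; now apply h. }
  destruct (orthogonal_decomposition L x hL hx) as (p & q & Lp & hq & hort & ->).
  pose proof hL as (Ll2 & L0 & Ladd & Lscale & Lcl).
  assert (E : ip (vadd p q) q = 0).
  { apply orthogonal_weak_limit with u B; try assumption.
    exists J; intros j hj; destruct (h j hj) as [h1 h2]; auto. }
  rewrite ip_add_l, hort in E by auto.
  replace (vadd p q) with p; [exact Lp|].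
  rewrite (ip_zero_eq q hq) by lra; vext.
Qed.

(* The component [q] of [x] orthogonal to [L] satisfies [<q,q> = c <T q,q>]. *)
Lemma coercive_solution L (T : (nat -> C) -> nat -> C) (x : nat -> C) (c e : R) :
  closed_sub L ->
  (forall a b, T (vadd a b) = vadd (T a) (T b)) ->
  (forall a, l2 a -> l2 (T a)) ->
  (forall a, L a -> L (T a)) ->
  (forall q, l2 q -> c * ip (T q) q <= e * ip q q) -> e < 1 ->
  (exists g, L g /\ x = vadd g (vscale (RtoC c) (T x))) -> l2 x -> L x.
Proof.
  intros hL Tadd Tl2 TL hT he (g & Lg & hg) hx.
  destruct (orthogonal_decomposition L x hL hx) as (p & q & Lp & hq & hort & E).
  destruct hL as (Ll2 & L0 & Ladd & Lscale & Lcl).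
  (* The left side is expanded through the equation for [x], the right side through [x = p + q]. *)
  assert (E' : ip x q = ip x q) by reflexivity.
  rewrite hg, E, Tadd in E' at 1.
  rewrite E in E'.
  rewrite (ip_add_l g), ip_scale_l, (ip_add_l (T p)), (ip_add_l p),
    (hort g), (hort (T p)), (hort p) in E'
    by auto 10 with l2.
  specialize (hT q hq); pose proof (ip_pos q hq).
  replace x with p; [exact Lp|].
  rewrite E, (ip_zero_eq q hq) by nra; vext.
Qed.

(** * Adjoints of bounded operators *)

Definition delta (k : nat) : nat -> C := fun n => if Nat.eqb n k then RtoC 1 else RtoC 0.

(** Real pairing with [delta k] and with [Ci] times [delta k] reads off the real and imaginary parts
    of an entry, so real linearity of [T] is enough. *)
Definition adjoint (T : (nat -> C) -> nat -> C) (c : nat -> C) : nat -> C :=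
  fun k => (ip (T (delta k)) c, ip (T (vscale Ci (delta k))) c).

Lemma l2_delta k : l2 (delta k).
Proof.
  exists 1; intros N.
  apply Rle_trans with (if Nat.leb k N then 1 else 0).
  2: destruct (Nat.leb k N); lra.
  induction N as [|N IH].
  - rewrite psum_O; unfold delta, dot, Re, Im; destruct k; simpl; lra.
  - rewrite psum_S; unfold delta at 3 4, dot; revert IH.
    destruct (Nat.eqb_spec (S N) k), (Nat.leb_spec k N), (Nat.leb_spec k (S N));
      simpl; try lia; intros; lra.
Qed.
#[local] Hint Resolve l2_delta : l2.

Section Adjoint.

Context (T : (nat -> C) -> nat -> C) (A : R).
Context (Tadd : forall a b, T (vadd a b) = vadd (T a) (T b)).
Context (Tscale : forall r a, T (vscale (RtoC r) a) = vscale (RtoC r) (T a)).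
Context (Tbound : forall a N, psum (T a) (T a) N <= A * psum a a N).
Context (A_pos : 0 <= A).

Lemma bounded_l2 a : l2 a -> l2 (T a).
Proof.
  intros ha; exists (A * ip a a); intros N; eapply Rle_trans; [apply Tbound|].
  apply Rmult_le_compat_l; [exact A_pos | now apply psum_le_ip].
Qed.
#[local] Hint Resolve bounded_l2 : l2.

Lemma bounded_ip a : l2 a -> ip (T a) (T a) <= A * ip a a.
Proof. intros ha; apply ip_le; auto with l2. Qed.

(** Coordinates move from the tail to the head one at a time; by real linearity the [k]-th one
    contributes [dot (b k) (adjoint T c k)]. *)
Lemma ip_adjoint_head b c K : l2 b -> l2 c ->
  ip (T b) c = psum b (adjoint T c) K + ip (T (tail K b)) c.
Proof.
  intros hb hc.
  assert (H : forall a k, l2 a ->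
    ip (T (vadd (vadd (vscale (RtoC (Re (b k))) (delta k))
                      (vscale (RtoC (Im (b k))) (vscale Ci (delta k)))) a)) c
    = dot (b k) (adjoint T c k) + ip (T a) c).
  { intros a k ha; rewrite !Tadd, !Tscale; ip_expand.
    unfold dot, adjoint; simpl; ring. }
  induction K as [|K IH].
  - rewrite psum_O, <- H by auto with l2; do 2 f_equal.
    apply functional_extensionality; intros [|n];
      unfold vadd, vscale, delta, tail; apply injective_projections; simpl;
      unfold Re, Im; ring.
  - rewrite psum_S, IH, Rplus_assoc, <- H by auto with l2; do 3 f_equal.
    apply functional_extensionality; intros n; unfold vadd, vscale, delta, tail.
    destruct (Nat.leb_spec n K), (Nat.leb_spec n (S K)), (Nat.eqb_spec n (S K)); subst;
      try lia; apply injective_projections; simpl; unfold Re, Im; ring.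
Qed.

(** Duality: with [b] the truncation of [y = adjoint T c] at [K], the truncated square sum of [y]
    equals [<T b, c>]. Cauchy-Schwarz and the bound on [T] make its square at most [A |c|^2] times
    itself, and one factor cancels. *)
Lemma l2_adjoint c : l2 c -> l2 (adjoint T c).
Proof.
  intros hc; exists (A * ip c c); intros K.
  set (y := adjoint T c).
  set (b := fun n => if Nat.leb n K then y n else RtoC 0).
  assert (hb : forall N, psum b b N <= psum y y K).
  { induction N as [|N IH].
    - rewrite psum_O; unfold b; simpl; destruct K; [rewrite psum_O; lra|].
      eapply Rle_trans; [|apply (psum_mono y O); lia]; rewrite psum_O; lra.
    - destruct (Nat.leb_spec (S N) K) as [l|l].
      + eapply Rle_trans; [|apply (psum_mono y (S N)); lia].
        apply psum_le; intros n hn; unfold b; rewrite (proj2 (Nat.leb_le _ _)) by lia; lra.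
      + rewrite psum_S; unfold b at 3 4; rewrite (proj2 (Nat.leb_gt _ _)) by lia.
        unfold dot, Re, Im; simpl; unfold b in *; lra. }
  assert (lb : l2 b) by (eexists; apply hb).
  assert (E : psum y y K = ip (T b) c).
  { rewrite (ip_adjoint_head b c K) by auto with l2.
    replace (tail K b) with (vscale (RtoC 0) b).
    - rewrite Tscale, ip_scale_l by auto with l2.
      enough (psum y y K = psum b (adjoint T c) K) by lra.
      apply Rle_antisym; apply psum_le; intros n hn; unfold b;
        rewrite (proj2 (Nat.leb_le _ _)) by lia; apply Rle_refl.
    - apply functional_extensionality; intros n; unfold vscale, tail, b.
      destruct (Nat.leb n K); apply injective_projections; simpl; ring. }
  pose proof (ip_cauchy_schwarz (T b) c ltac:(auto with l2) hc) as cs; rewrite <- E in cs.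
  pose proof (bounded_ip b lb) as h1; pose proof (ip_le_bound b _ hb) as h2.
  pose proof (ip_pos c hc) as h3; pose proof (psum_pos y K) as h4.
  assert (h5 : ip (T b) (T b) <= A * psum y y K) by nra.
  assert (h6 : psum y y K ^ 2 <= psum y y K * (A * ip c c)) by nra.
  destruct (Req_dec (psum y y K) 0) as [e|ne]; [rewrite e; nra|].
  apply Rmult_le_reg_l with (psum y y K); nra.
Qed.

Lemma ip_adjoint b c : l2 b -> l2 c -> ip (T b) c = ip b (adjoint T c).
Proof.
  intros hb hc; symmetry; apply ip_unique.
  assert (Hl : is_lim_seq (fun K => ip (T (tail K b)) c) 0).
  { apply is_lim_seq_abs_0.
    apply is_lim_seq_le_le with (u := fun _ => 0)
      (w := fun K => sqrt (A * ip c c * ip (tail K b) (tail K b))).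
    - intros K; split; [apply Rabs_pos|].
      rewrite <- sqrt_Rsqr_abs; apply sqrt_le_1_alt; unfold Rsqr.
      pose proof (ip_cauchy_schwarz (T (tail K b)) c ltac:(auto with l2) hc).
      pose proof (bounded_ip (tail K b) ltac:(auto with l2)); pose proof (ip_pos c hc). nra.
    - apply is_lim_seq_const.
    - rewrite <- sqrt_0 at 1; apply (is_lim_seq_continuous sqrt); [apply continuity_pt_sqrt; lra|].
      replace (Finite 0) with (Rbar_mult (A * ip c c) 0) by (simpl; f_equal; ring).
      apply is_lim_seq_scal_l; now apply tail_lim. }
  apply is_lim_seq_ext with (fun K => ip (T b) c - ip (T (tail K b)) c).
  - intros K; rewrite (ip_adjoint_head b c K) at 1 by assumption; ring.
  - replace (ip (T b) c) with (ip (T b) c - 0) at 1 by ring.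
    apply is_lim_seq_minus'; [apply is_lim_seq_const | exact Hl].
Qed.

End Adjoint.

(** * Hausdorff matrices *)

Definition shift (b : nat -> C) : nat -> C := fun k => b (S k).

(* [eul al be n b = sum_k C(n,k) al^(n-k) be^k b_k], the 0-th entry of
   [(al + be shift)^n b]. *)
Fixpoint eul (al be : R) (n : nat) (b : nat -> C) : C :=
  match n with
  | O => b O
  | S n => Cplus (Cmult (RtoC al) (eul al be n b)) (Cmult (RtoC be) (eul al be n (shift b)))
  end.

Definition euler (al be : R) (b : nat -> C) : nat -> C := fun n => eul al be n b.

Definition mulseq (m : nat -> R) (d : nat -> C) : nat -> C := fun k => Cmult (RtoC (m k)) (d k).

(* The Hausdorff matrix with multiplier [m]: diagonal in the basis of the
   sequences [n |-> C(n,k)]. *)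
Definition haus (m : nat -> R) (b : nat -> C) : nat -> C :=
  euler 1 1 (mulseq m (euler (-1) 1 b)).

Lemma eul_add al be n : forall a b,
  eul al be n (vadd a b) = Cplus (eul al be n a) (eul al be n b).
Proof.
  induction n as [|n IH]; intros a b; [reflexivity|]; simpl.
  change (shift (vadd a b)) with (vadd (shift a) (shift b)); rewrite !IH; ring.
Qed.

Lemma eul_scale al be c n : forall a, eul al be n (vscale c a) = Cmult c (eul al be n a).
Proof.
  induction n as [|n IH]; intros a; [reflexivity|]; simpl.
  change (shift (vscale c a)) with (vscale c (shift a)); rewrite !IH; ring.
Qed.

Lemma euler_add al be a b : euler al be (vadd a b) = vadd (euler al be a) (euler al be b).
Proof. apply functional_extensionality; intros n; apply eul_add. Qed.

Lemma euler_scale al be c a : euler al be (vscale c a) = vscale c (euler al be a).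
Proof. apply functional_extensionality; intros n; apply eul_scale. Qed.

Lemma shift_euler al be b :
  shift (euler al be b) =
  vadd (vscale (RtoC al) (euler al be b)) (vscale (RtoC be) (euler al be (shift b))).
Proof. reflexivity. Qed.

(** These matrices send the powers of [z] to the powers of [al + be z], so they multiply as affine
    maps compose. *)
Lemma euler_comp al be ga de b :
  euler al be (euler ga de b) = euler (al + be * ga) (be * de) b.
Proof.
  apply functional_extensionality; intros n; unfold euler at 1 3; revert b.
  induction n as [|n IH]; intros b; [reflexivity|]; simpl.
  rewrite shift_euler, eul_add, !eul_scale, !IH, RtoC_plus, !RtoC_mult; ring.
Qed.

Lemma euler_0 r b : euler 0 r b = mulseq (fun k => r ^ k) b.
Proof.
  apply functional_extensionality; intros n; unfold euler, mulseq; revert b.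
  induction n as [|n IH]; intros b; simpl; [ring|].
  rewrite !IH, RtoC_mult; unfold shift; ring.
Qed.

Lemma euler_id b : euler 0 1 b = b.
Proof.
  rewrite euler_0; apply functional_extensionality; intros n; unfold mulseq.
  rewrite pow1; ring.
Qed.

(** Binomial inversion: [euler (-1) 1] takes iterated differences at 0, the coefficients of Newton's
    expansion, which [euler 1 1] sums. *)
Lemma euler_newton b : euler 1 1 (euler (-1) 1 b) = b.
Proof.
  rewrite euler_comp, <- euler_id; f_equal; ring.
Qed.

Lemma euler_newton' b : euler (-1) 1 (euler 1 1 b) = b.
Proof.
  rewrite euler_comp, <- euler_id; f_equal; ring.
Qed.

Lemma haus_add m a b : haus m (vadd a b) = vadd (haus m a) (haus m b).
Proof.
  unfold haus; rewrite (euler_add (-1)), <- (euler_add 1); f_equal.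
  unfold mulseq; vext.
Qed.

Lemma haus_mul m m' b : haus m (haus m' b) = haus (fun k => m k * m' k) b.
Proof.
  unfold haus; rewrite euler_newton'; f_equal; unfold mulseq; vext.
Qed.

Lemma haus_one m b : (forall k, m k = 1) -> haus m b = b.
Proof.
  intros h; unfold haus; rewrite <- (euler_newton b) at 2; f_equal.
  unfold mulseq; vext; rewrite h; ring.
Qed.

Lemma haus_lin m m1 m2 r s b : (forall k, m k = r * m1 k + s * m2 k) ->
  haus m b = vadd (vscale (RtoC r) (haus m1 b)) (vscale (RtoC s) (haus m2 b)).
Proof.
  intros h; unfold haus; rewrite <- !euler_scale, <- euler_add; f_equal.
  unfold mulseq; vext; rewrite h; ring.
Qed.

(** Scaling by [r] conjugated by a unit translation: [1 + r (z - 1) = (1 - r) + r z]. *)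
Lemma haus_pow r b : haus (fun k => r ^ k) b = euler (1 - r) r b.
Proof.
  unfold haus; rewrite <- euler_0, !euler_comp; f_equal; ring.
Qed.

(** The matrix is lower triangular, so each entry of the image involves finitely many
    multipliers. *)
Lemma cvg_haus (m : nat -> nat -> R) (m0 : nat -> R) b :
  (forall k, is_lim_seq (fun j => m j k) (m0 k)) ->
  cvg (fun j => haus (m j) b) (haus m0 b).
Proof.
  intros h n; unfold haus; set (d := euler (-1) 1 b).
  assert (H : forall n (u : nat -> nat -> C) x, cvg u x ->
    is_lim_seq (fun j => Re (eul 1 1 n (u j))) (Re (eul 1 1 n x)) /\
    is_lim_seq (fun j => Im (eul 1 1 n (u j))) (Im (eul 1 1 n x))).
  { clear; induction n as [|n IH]; intros u x hu; [apply hu|].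
    destruct (IH u x hu) as [h1 h2].
    destruct (IH (fun j => shift (u j)) (shift x) (fun k => hu (S k))) as [h3 h4].
    split.
    - replace (Re (eul 1 1 (S n) x)) with (Re (eul 1 1 n x) + Re (eul 1 1 n (shift x)))
        by (unfold Re; simpl; ring).
      apply is_lim_seq_ext with (2 := is_lim_seq_plus' _ _ _ _ h1 h3).
      intros j; unfold Re; simpl; ring.
    - replace (Im (eul 1 1 (S n) x)) with (Im (eul 1 1 n x) + Im (eul 1 1 n (shift x)))
        by (unfold Im; simpl; ring).
      apply is_lim_seq_ext with (2 := is_lim_seq_plus' _ _ _ _ h2 h4).
      intros j; unfold Im; simpl; ring. }
  apply H; intros k; split.
  - replace (Re (mulseq m0 d k)) with (m0 k * Re (d k)) by (unfold mulseq, Re; simpl; ring).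
    apply is_lim_seq_ext with (2 := is_lim_seq_mult' _ _ _ _ (h k) (is_lim_seq_const _)).
    intros j; unfold mulseq, Re; simpl; ring.
  - replace (Im (mulseq m0 d k)) with (m0 k * Im (d k)) by (unfold mulseq, Im; simpl; ring).
    apply is_lim_seq_ext with (2 := is_lim_seq_mult' _ _ _ _ (h k) (is_lim_seq_const _)).
    intros j; unfold mulseq, Im; simpl; ring.
Qed.

(** * Norm bounds for the semigroup matrices *)

Lemma psum_shift a N :
  psum a a (S N) = dot (a O) (a O) + psum (shift a) (shift a) N.
Proof.
  induction N as [|N IH]; [rewrite psum_S, !psum_O; reflexivity|].
  rewrite psum_S, IH, psum_S; unfold shift; ring.
Qed.

(** Since [shift E = (1 - r) E + r E'], convexity gives [|shift E|^2 <= (1 - r) |E|^2 + r |E'|^2].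
    The first term is absorbed on the left, and induction applied to [shift b] controls the
    second. *)
Lemma euler_bound r N : 0 <= r <= 1 -> forall b,
  r * psum (euler (1 - r) r b) (euler (1 - r) r b) N <= psum b b N.
Proof.
  intros hr; induction N as [|N IH]; intros b.
  - rewrite !psum_O; pose proof (dot_pos (b O)); unfold euler; simpl; nra.
  - set (E := euler (1 - r) r b).
    specialize (IH (shift b)).
    set (E' := euler (1 - r) r (shift b)) in *.
    assert (h1 : psum (shift E) (shift E) N <= (1 - r) * psum E E N + r * psum E' E' N).
    { unfold E at 1 2; rewrite shift_euler; fold E E'.
      assert (hr' : 0 <= r * (1 - r)) by nra.
      pose proof (Rmult_le_pos _ _ hr' (psum_pos (vsub E E') N)) as h; revert h.
      psum_expand; rewrite (psum_sym E' E); lra. }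
    pose proof (psum_mono E N (S N) ltac:(lia)) as h2.
    assert (h3 : (1 - r) * psum E E N <= (1 - r) * psum E E (S N))
      by (apply Rmult_le_compat_l; lra).
    pose proof (psum_shift E N) as h4; rewrite (psum_shift b N).
    change (E O) with (b O) in h4; lra.
Qed.

Lemma euler_sq_bound r a N : 0 < r <= 1 ->
  psum (euler (1 - r) r a) (euler (1 - r) r a) N <= / r * psum a a N.
Proof.
  intros hr; pose proof (euler_bound r N ltac:(lra) a).
  apply Rmult_le_reg_l with r; [lra|].
  rewrite <- Rmult_assoc, Rinv_r by lra; lra.
Qed.

Lemma l2_euler r a : 0 < r <= 1 -> l2 a -> l2 (euler (1 - r) r a).
Proof.
  intros hr; apply bounded_l2 with (/ r); [|left; apply Rinv_0_lt_compat; lra].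
  intros; now apply euler_sq_bound.
Qed.

(** * The generator and its resolvents *)

Lemma euler_mul_index n : forall d,
  eul 1 1 (S n) (mulseq INR d) =
  Cmult (RtoC (INR (S n))) (Cminus (eul 1 1 (S n) d) (eul 1 1 n d)).
Proof.
  (* This is [k C(n+1,k) = (n+1) C(n,k-1)]; Pascal's rule then produces the backward difference. *)
  assert (H : forall n d, eul 1 1 (S n) (mulseq INR d) =
                          Cmult (RtoC (INR (S n))) (eul 1 1 n (shift d))).
  { clear n; intros n; induction n as [|n IH]; intros d.
    - simpl; unfold mulseq, shift; simpl; ring.
    - change (eul 1 1 (S (S n)) (mulseq INR d)) with
        (Cplus (Cmult (RtoC 1) (eul 1 1 (S n) (mulseq INR d)))
               (Cmult (RtoC 1) (eul 1 1 (S n) (shift (mulseq INR d))))).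
      replace (shift (mulseq INR d)) with (vadd (mulseq INR (shift d)) (shift d)).
      2: { apply functional_extensionality; intros k; unfold vadd, mulseq, shift.
           rewrite S_INR, RtoC_plus; ring. }
      rewrite eul_add, !IH, (S_INR (S n)), RtoC_plus.
      simpl eul; ring. }
  intros d; rewrite H; simpl eul; ring.
Qed.

(* [haus (fun k => / (1 + h k))] is the resolvent [(1 - h G)^-1] of the generator
   [(G x)_n = - n (x_n - x_(n-1))] of the semigroup [t |-> haus (fun k => exp (- t k))]. *)
Definition resolvent (h : R) : (nat -> C) -> nat -> C := haus (fun k => / (1 + h * INR k)).

Lemma resolvent_O h b : resolvent h b O = b O.
Proof.
  unfold resolvent, haus, euler, mulseq; simpl.
  rewrite Rmult_0_r, Rplus_0_r, Rinv_1; ring.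
Qed.

(** The coordinate form of [(1 - h G) x = b]: multiplying the Newton coefficients of [x] by
    [1 + h k] recovers those of [b]. *)
Lemma resolvent_S h b n : 0 <= h ->
  b (S n) = Cplus (resolvent h b (S n))
    (Cmult (RtoC (h * INR (S n))) (Cminus (resolvent h b (S n)) (resolvent h b n))).
Proof.
  intros hh; unfold resolvent, haus.
  set (d := mulseq (fun k => / (1 + h * INR k)) (euler (-1) 1 b)).
  transitivity (euler 1 1 (euler (-1) 1 b) (S n)); [now rewrite euler_newton|].
  replace (euler (-1) 1 b) with (vadd d (vscale (RtoC h) (mulseq INR d))).
  - rewrite euler_add, euler_scale; unfold vadd, vscale.
    unfold euler; rewrite euler_mul_index, (RtoC_mult h); ring.
  - assert (hk : forall k, 1 + h * INR k <> 0).
    { intros k; pose proof (pos_INR k); nra. }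
    unfold d, mulseq; vext; field; apply hk.
Qed.

Lemma resolvent_coercive h b N : 0 <= h ->
  (1 - h / 2) * psum (resolvent h b) (resolvent h b) N <= psum b (resolvent h b) N.
Proof.
  intros hh; set (x := resolvent h b).
  (* The boundary term of the summation by parts is kept to close the induction; being nonnegative,
     it is dropped afterwards. *)
  assert (H : (1 - h / 2) * psum x x N + h / 2 * INR (S N) * dot (x N) (x N) <= psum b x N).
  { induction N as [|N IH].
    - rewrite !psum_O; rewrite <- (resolvent_O h b); simpl INR; fold x; lra.
    - rewrite !psum_S; rewrite (resolvent_S h b N hh); fold x.
      set (u := x N) in *; set (v := x (S N)) in *.
      assert (E : dot (Cplus v (Cmult (RtoC (h * INR (S N))) (Cminus v u))) v
                  = dot v v + h * INR (S N) * (dot v v - dot u v))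
        by (unfold dot, Re, Im; simpl; ring).
      rewrite E, (S_INR (S N)).
      assert (hc : 2 * dot u v <= dot u u + dot v v).
      { unfold dot; pose proof (Rle_0_sqr (Re u - Re v)); pose proof (Rle_0_sqr (Im u - Im v));
          unfold Rsqr in *; lra. }
      assert (hp : 0 <= h * INR (S N)) by (apply Rmult_le_pos; [lra | apply pos_INR]).
      nra. }
  pose proof (dot_pos (x N)); pose proof (pos_INR (S N)).
  assert (0 <= h / 2 * INR (S N) * dot (x N) (x N)); [|lra].
  apply Rmult_le_pos; [apply Rmult_le_pos; lra | assumption].
Qed.

Lemma resolvent_bound h b N : 0 <= h <= 1 ->
  psum (resolvent h b) (resolvent h b) N <= (1 + h) ^ 2 * psum b b N.
Proof.
  intros hh.
  pose proof (psum_coercive _ _ _ _ (resolvent_coercive h b N ltac:(lra)) ltac:(lra)) as H.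
  pose proof (psum_pos (resolvent h b) N) as hp.
  (* For [0 <= h <= 1] one has [(1 + h) (1 - h / 2) >= 1]; the factor [1 + h] compares easily with
     [exp h] when steps are iterated. *)
  apply Rle_trans with ((1 + h) ^ 2 * ((1 - h / 2) ^ 2 * psum (resolvent h b) (resolvent h b) N)).
  - rewrite <- Rmult_assoc, <- Rpow_mult_distr.
    rewrite <- (Rmult_1_l (psum _ _ _)) at 1; apply Rmult_le_compat_r; [exact hp|].
    rewrite <- (pow1 2); apply pow_incr; nra.
  - apply Rmult_le_compat_l; [apply pow2_ge_0 | exact H].
Qed.

Lemma l2_resolvent h b : 0 <= h <= 1 -> l2 b -> l2 (resolvent h b).
Proof.
  intros hh hb; exists ((1 + h) ^ 2 * ip b b); intros N.
  eapply Rle_trans; [now apply resolvent_bound|].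
  apply Rmult_le_compat_l; [apply pow2_ge_0 | now apply psum_le_ip].
Qed.

(** For [h = 1] the recurrence reads [(n+2) x_(n+1) = (n+1) x_n + b_(n+1)], which is that of the
    averages. *)
Lemma resolvent_cesaro b n :
  resolvent 1 b n = Cmult (RtoC (/ INR (S n))) (@sum_n C_AbelianMonoid b n).
Proof.
  assert (hn : forall n, INR (S n) <> 0) by (intros; apply not_0_INR; lia).
  induction n as [|n IH].
  - rewrite resolvent_O, sum_O; simpl; rewrite Rinv_1; ring.
  - rewrite sum_Sn.
    replace (@sum_n C_AbelianMonoid b n) with (Cmult (RtoC (INR (S n))) (resolvent 1 b n)).
    2: { rewrite IH, Cmult_assoc, <- RtoC_mult, Rinv_r by apply hn; ring. }
    change (resolvent 1 b (S n) = Cmult (RtoC (/ INR (S (S n))))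
      (Cplus (Cmult (RtoC (INR (S n))) (resolvent 1 b n)) (b (S n)))).
    rewrite (resolvent_S 1 b n) by lra.
    transitivity (Cmult (RtoC (/ INR (S (S n)) * INR (S (S n)))) (resolvent 1 b (S n))).
    + rewrite Rinv_l by apply hn; ring.
    + set (i := / INR (S (S n))).
      rewrite RtoC_mult, (S_INR (S n)), RtoC_plus, Rmult_1_l; ring.
Qed.

(** * From the Cesaro operator to the semigroup *)

Lemma resolvent_invariant L h b : closed_sub L ->
  (forall a, L a -> L (resolvent 1 a)) -> 0 <= h <= 1 -> L b -> L (resolvent h b).
Proof.
  intros hL hC hh Lb; destruct (Req_dec h 0) as [->|h0].
  { unfold resolvent; rewrite haus_one; [exact Lb|].
    intros k; rewrite Rmult_0_l, Rplus_0_r; apply Rinv_1. }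
  assert (lb : l2 b) by (now apply hL).
  (* The constants come from [1/(1+hk) = (1/h) 1/(1+k) - ((1-h)/h) 1/(1+k) 1/(1+hk)]. Here [c <= 0],
     while [<T q, q> >= 0] by coercivity at [h = 1]. *)
  apply coercive_solution with (T := resolvent 1) (c := - (1 - h) / h) (e := 0); try assumption.
  - intros; apply haus_add.
  - intros; apply l2_resolvent; [lra | assumption].
  - intros q hq.
    assert (0 <= ip (resolvent 1 q) q).
    { assert (hr : l2 (resolvent 1 q)) by (apply l2_resolvent; [lra | assumption]).
      pose proof (ip_pos _ hr).
      enough (ip (resolvent 1 q) (resolvent 1 q) <= 2 * ip (resolvent 1 q) q) by lra.
      apply ip_le; try assumption; intros N.
      pose proof (resolvent_coercive 1 q N ltac:(lra)); rewrite (psum_sym _ q); lra. }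
    assert (- (1 - h) / h <= 0).
    { unfold Rdiv; assert (0 < / h) by (apply Rinv_0_lt_compat; lra); nra. }
    nra.
  - lra.
  - exists (vscale (RtoC (/ h)) (resolvent 1 b)); split.
    { apply closed_sub_scale; auto. }
    unfold resolvent; rewrite haus_mul; apply haus_lin; intros k.
    pose proof (pos_INR k); field; repeat split; nra.
  - now apply l2_resolvent.
Qed.

(** With [u = x/n], the inequality [1 + y <= exp y] at [y = u] and at [y = - u/(1+u)] squeezes the
    power between [exp (- x)] and [exp (- x/(1+u))]. *)
Lemma is_lim_seq_euler_exp x : 0 <= x ->
  is_lim_seq (fun j => (/ (1 + x / INR (S j))) ^ S j) (exp (- x)).
Proof.
  intros hx.
  assert (E : forall y n, exp y ^ n = exp (INR n * y)).
  { intros y n; induction n as [|n IH]; [simpl; now rewrite Rmult_0_l, exp_0|].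
    simpl pow; rewrite IH, <- exp_plus, S_INR; f_equal; ring. }
  assert (hn : forall j, 0 < INR (S j)) by (intros; apply lt_0_INR; lia).
  assert (hu : forall j, 0 <= x / INR (S j)).
  { intros j; apply Rdiv_le_0_compat; [exact hx | apply hn]. }
  apply is_lim_seq_le_le with (u := fun _ => exp (- x))
    (w := fun j => exp (- (x * / (1 + x * / INR (S j))))).
  - intros j; specialize (hn j); specialize (hu j); set (u := x / INR (S j)) in *.
    assert (hinv : 0 < / (1 + u)) by (apply Rinv_0_lt_compat; lra).
    split.
    + replace (- x) with (INR (S j) * - u) by (unfold u; field; lra).
      rewrite <- E; apply pow_incr; split; [left; apply exp_pos|].
      rewrite exp_Ropp; apply Rinv_le_contravar; [lra | apply exp_ineq1_le].
    + replace (- (x * / (1 + x * / INR (S j)))) with (INR (S j) * (- (u / (1 + u)))).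
      * rewrite <- E; apply pow_incr; split; [lra|].
        replace (/ (1 + u)) with (1 + - (u / (1 + u))) by (field; lra).
        apply exp_ineq1_le.
      * unfold u in *; field; split; [lra|]. unfold Rdiv in *.
        assert (x = x * / INR (S j) * INR (S j)) by (field; lra); nra.
  - apply is_lim_seq_const.
  - apply (is_lim_seq_continuous exp); [apply derivable_continuous, derivable_exp|].
    replace (Finite (- x)) with (Rbar_opp (x * / (1 + x * 0)))
      by (simpl; do 2 f_equal; field).
    apply (is_lim_seq_opp _ (x * / (1 + x * 0))).
    apply is_lim_seq_mult'; [apply is_lim_seq_const|].
    apply (is_lim_seq_inv _ (1 + x * 0)); [|simpl; intros e; injection e; lra].
    apply is_lim_seq_plus'; [apply is_lim_seq_const|].
    apply is_lim_seq_mult'; [apply is_lim_seq_const | apply is_lim_seq_inv_S].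
Qed.

Lemma euler_invariant L t b : closed_sub L ->
  (forall a, L a -> L (resolvent 1 a)) -> 0 <= t -> L b ->
  L (euler (1 - exp (- t)) (exp (- t)) b).
Proof.
  intros hL hC ht Lb; rewrite <- haus_pow.
  set (h := fun j => t / INR (S j)).
  set (m := fun j n k => (/ (1 + h j * INR k)) ^ n).
  assert (hh : forall j, 0 <= h j).
  { intros j; apply Rdiv_le_0_compat; [exact ht | apply lt_0_INR; lia]. }
  assert (mS : forall j n, haus (m j (S n)) b = resolvent (h j) (haus (m j n) b)).
  { intros j n; unfold resolvent; rewrite haus_mul; reflexivity. }
  (* Each backward Euler step costs [(1 + h)^2 <= exp (2 h)], so the [j + 1] steps of size
     [t / (j + 1)] cost at most [exp (2 t)], uniformly in [j]. *)
  assert (H : forall j n, h j <= 1 -> L (haus (m j n) b) /\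
     forall N, psum (haus (m j n) b) (haus (m j n) b) N <= exp (INR n * (2 * h j)) * psum b b N).
  { intros j n hj; induction n as [|n [IH1 IH2]].
    - rewrite haus_one by reflexivity; split; [exact Lb|]; intros N.
      simpl; rewrite Rmult_0_l, exp_0; lra.
    - rewrite mS; split; [now apply resolvent_invariant|]; intros N.
      eapply Rle_trans; [now apply resolvent_bound|].
      rewrite S_INR, Rmult_plus_distr_r, Rmult_1_l, exp_plus, (Rmult_comm (exp _)), Rmult_assoc.
      apply Rmult_le_compat; [apply pow2_ge_0 | apply psum_pos | | apply IH2].
      replace (2 * h j) with (h j + h j) by ring; rewrite exp_plus.
      pose proof (exp_ineq1_le (h j)); specialize (hh j); nra. }
  apply closed_sub_weak with (u := fun j => haus (m j (S j)) b) (B := exp (2 * t) * ip b b);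
    [exact hL| |].
  (* From the integer part of [t] onwards the step size is at most 1. *)
  - destruct (nfloor_ex t ht) as [J hJ]; exists J; intros j hj.
    assert (hj1 : h j <= 1).
    { unfold h; apply Rle_div_l; [apply lt_0_INR; lia|].
      apply le_INR in hj; rewrite S_INR; lra. }
    destruct (H j (S j) hj1) as [H1 H2]; split; [exact H1|]; intros N.
    eapply Rle_trans; [apply H2|].
    replace (INR (S j) * (2 * h j)) with (2 * t)
      by (unfold h; field; apply not_0_INR; lia).
    apply Rmult_le_compat_l; [left; apply exp_pos|]; apply psum_le_ip; now apply hL.
  - apply cvg_haus; intros k.
    replace (exp (- t) ^ k) with (exp (- (t * INR k))).
    + apply is_lim_seq_ext with (2 := is_lim_seq_euler_exp (t * INR k)
        (Rmult_le_pos _ _ ht (pos_INR k))).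
      intros j; unfold m, h; do 3 f_equal; field; apply not_0_INR; lia.
    + induction k as [|k IH]; [simpl; now rewrite Rmult_0_r, Ropp_0, exp_0|].
      simpl pow; rewrite <- IH, <- exp_plus, S_INR; f_equal; ring.
Qed.

(** * From the semigroup to the Cesaro operator *)

Lemma euler_coercive s b N : 0 <= s <= 1 ->
  s * psum (euler (1 - s ^ 2) (s ^ 2) b) b N <= psum b b N.
Proof.
  intros hs.
  pose proof (euler_bound (s ^ 2) N ltac:(nra) b) as h1.
  set (E := euler _ _ b) in *.
  (* Writing [r = s^2] avoids square roots: [2 s <E,b> <= s^2 |E|^2 + |b|^2 <= 2 |b|^2]. *)
  pose proof (psum_pos (vsub (vscale (RtoC s) E) b) N) as h2; revert h2.
  psum_expand; rewrite (psum_sym b E); nra.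
Qed.

(* Abel-type means [(1 - r) sum_j r^j S^j] of the semigroup [S = euler (1 - r) r], which
   tend to the Cesaro operator as [r] tends to [1]. *)
Definition geometric_mean (r : R) : (nat -> C) -> nat -> C :=
  haus (fun k => / sum_f_R0 (fun j => r ^ j) k).

Lemma sum_pow_pos r k : 0 <= r -> 0 < sum_f_R0 (fun j => r ^ j) k.
Proof.
  intros hr; induction k as [|k IH]; simpl; [lra|].
  pose proof (pow_le r k hr); nra.
Qed.

(** The multiplier is [m = (1 - r) / (1 - r^(k+1))], which solves [m = (1 - r) + r r^k m]. *)
Lemma geometric_mean_eq r b : 0 <= r < 1 ->
  geometric_mean r b = vadd (vscale (RtoC (1 - r)) b)
    (vscale (RtoC r) (euler (1 - r) r (geometric_mean r b))).
Proof.
  intros hr; unfold geometric_mean; rewrite <- (haus_pow r), haus_mul.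
  rewrite <- (haus_one (fun _ => 1) b) at 2 by reflexivity.
  apply haus_lin; intros k.
  pose proof (sum_pow_pos r k ltac:(lra)) as hp.
  assert (E : (1 - r) * sum_f_R0 (fun j => r ^ j) k = 1 - r * r ^ k).
  { rewrite tech3 by lra; simpl; field; lra. }
  set (S := sum_f_R0 _ k) in *.
  apply Rmult_eq_reg_r with S; [|lra].
  rewrite Rinv_l by lra. rewrite Rmult_plus_distr_r, !Rmult_assoc, Rinv_l by lra. nra.
Qed.

Lemma geometric_mean_bound s b N : 0 <= s < 1 ->
  psum (geometric_mean (s ^ 2) b) (geometric_mean (s ^ 2) b) N <= 4 * psum b b N.
Proof.
  intros hs; set (y := geometric_mean (s ^ 2) b).
  pose proof (geometric_mean_eq (s ^ 2) b ltac:(nra)) as E; fold y in E.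
  pose proof (euler_coercive s y N ltac:(lra)) as h.
  set (z := euler _ _ y) in *.
  pose proof (psum_pos y N) as hp.
  assert (h1 : psum y y N = (1 - s ^ 2) * psum b y N + s ^ 2 * psum z y N).
  { rewrite E at 1; psum_expand; reflexivity. }
  (* Since [s <z,y> <= |y|^2], a factor [1 - s] appears on both sides and cancels; this keeps the
     bound uniform as [s] tends to 1. *)
  assert (h2 : psum y y N <= (1 + s) * psum b y N).
  { apply Rmult_le_reg_l with (1 - s); nra. }
  assert (h3 : / 2 * psum y y N <= psum b y N) by nra.
  pose proof (psum_coercive _ _ _ _ h3 ltac:(lra)); lra.
Qed.

Lemma geometric_mean_invariant L s b : closed_sub L ->
  (forall a, L a -> L (euler (1 - s ^ 2) (s ^ 2) a)) -> 0 < s < 1 -> L b ->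
  L (geometric_mean (s ^ 2) b).
Proof.
  intros hL hS hs Lb.
  assert (bl2 : forall a, l2 a -> l2 (euler (1 - s ^ 2) (s ^ 2) a))
    by (intros; apply l2_euler; [nra | assumption]).
  apply coercive_solution with (T := euler (1 - s ^ 2) (s ^ 2)) (c := s ^ 2) (e := s);
    try assumption.
  - apply euler_add.
  - intros q hq; pose proof (bl2 q hq) as hz.
    replace (s ^ 2 * ip (euler (1 - s ^ 2) (s ^ 2) q) q)
      with (s * (s * ip (euler (1 - s ^ 2) (s ^ 2) q) q)) by ring.
    apply Rmult_le_compat_l; [lra|].
    rewrite <- ip_scale_l, <- (Rmult_1_l (ip q q)) by assumption.
    apply ip_le; auto with l2; intros N; rewrite psum_scale_l, Rmult_1_l.
    apply euler_coercive; lra.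
  - lra.
  - exists (vscale (RtoC (1 - s ^ 2)) b); split; [now apply closed_sub_scale|].
    apply geometric_mean_eq; nra.
  - exists (4 * ip b b); intros N; eapply Rle_trans; [apply geometric_mean_bound; lra|].
    apply Rmult_le_compat_l; [lra|]; apply psum_le_ip; now apply hL.
Qed.

Lemma resolvent_1_invariant L b : closed_sub L ->
  (forall r a, 0 < r <= 1 -> L a -> L (euler (1 - r) r a)) -> L b -> L (resolvent 1 b).
Proof.
  intros hL hS Lb.
  (* The denominator [j + 2] keeps [s 0] positive. *)
  set (s := fun j => 1 - / INR (S (S j))).
  assert (hs : forall j, 0 < s j < 1).
  { intros j; unfold s; pose proof (pos_INR j).
    assert (hj : 1 < INR (S (S j))) by (rewrite !S_INR; lra).
    assert (0 < / INR (S (S j))) by (apply Rinv_0_lt_compat; lra).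
    assert (/ INR (S (S j)) < 1); [|lra].
    rewrite <- Rinv_1; apply Rinv_lt_contravar; lra. }
  assert (slim : is_lim_seq (fun j => s j ^ 2) 1).
  { assert (h1 : is_lim_seq s 1).
    { replace 1 with (1 - 0) at 1 by ring; apply is_lim_seq_minus'; [apply is_lim_seq_const|].
      apply (is_lim_seq_incr_1 (fun j => / INR (S j))), is_lim_seq_inv_S. }
    replace 1 with (1 * 1) by ring.
    apply is_lim_seq_ext with (2 := is_lim_seq_mult' _ _ _ _ h1 h1); intros; ring. }
  apply closed_sub_weak with (u := fun j => geometric_mean (s j ^ 2) b) (B := 4 * ip b b);
    [exact hL| |].
  - exists O; intros j _; specialize (hs j); split.
    + apply geometric_mean_invariant; try assumption.
      intros; apply hS; [nra | assumption].
    + intros N; eapply Rle_trans; [apply geometric_mean_bound; lra|].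
      apply Rmult_le_compat_l; [lra|]; apply psum_le_ip; now apply hL.
  - apply cvg_haus; intros k.
    (* The limit is written in the shape of the multiplier of [resolvent 1]. *)
    assert (hl : is_lim_seq (fun j => sum_f_R0 (fun i => (s j ^ 2) ^ i) k) (1 + 1 * INR k)).
    { assert (hp : forall i, is_lim_seq (fun j => (s j ^ 2) ^ i) 1).
      { induction i as [|i IH]; [apply is_lim_seq_const|].
        replace 1 with (1 * 1) by ring; now apply is_lim_seq_mult'. }
      induction k as [|k IH].
      - simpl INR; rewrite Rmult_0_r, Rplus_0_r; apply hp.
      - rewrite S_INR; replace (1 + 1 * (INR k + 1)) with (1 + 1 * INR k + 1) by ring.
        now apply is_lim_seq_plus'. }
    apply (is_lim_seq_inv _ (1 + 1 * INR k)); [exact hl|].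
    pose proof (pos_INR k); intros e; injection e; lra.
Qed.

(** * Coefficients of functions on the disc *)

Lemma is_series_C_pair (u : nat -> C) (x y : R) :
  is_series (fun n => Re (u n)) x -> is_series (fun n => Im (u n)) y ->
  @is_series C_AbsRing C_NormedModule u (x, y).
Proof.
  intros hx hy.
  assert (E : forall n, @sum_n C_AbelianMonoid u n =
    (@sum_n R_AbelianMonoid (fun k => Re (u k)) n, @sum_n R_AbelianMonoid (fun k => Im (u k)) n)).
  { induction n as [|n IH]; [rewrite !sum_O; now destruct (u O)|].
    rewrite !sum_Sn, IH; reflexivity. }
  apply (filterlim_locally (U := C_UniformSpace)); intros eps.
  pose proof (proj1 (filterlim_locally (U := R_UniformSpace) _ _) hx eps) as h1.
  pose proof (proj1 (filterlim_locally (U := R_UniformSpace) _ _) hy eps) as h2.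
  generalize (filter_and _ _ h1 h2); apply filter_imp; intros n h.
  rewrite E; exact h.
Qed.

Definition cinner (a b : nat -> C) : C := (ip a b, ip a (vscale Ci b)).

Lemma is_series_ip a b : l2 a -> l2 b -> is_series (fun n => dot (a n) (b n)) (ip a b).
Proof. intros ha hb; exact (is_lim_ip a b ha hb). Qed.

Lemma is_series_cinner a b : l2 a -> l2 b ->
  @is_series C_AbsRing C_NormedModule (fun n => Cmult (a n) (Cconj (b n))) (cinner a b).
Proof.
  intros ha hb; apply is_series_C_pair.
  - apply is_series_ext with (2 := is_series_ip a b ha hb).
    intros n; unfold dot, Re, Im; simpl; ring.
  - apply is_series_ext with (2 := is_series_ip a _ ha (l2_scale Ci b hb)).
    intros n; unfold dot, vscale, Re, Im; simpl; ring.
Qed.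

Definition powers (z : C) : nat -> C := fun n => Cpow z n.

Lemma dot_Cmod z : dot z z = Cmod z ^ 2.
Proof. rewrite Cmod2_alt; unfold dot; ring. Qed.

Lemma l2_ex_series a : l2 a <-> ex_series (fun n => Cmod (a n) ^ 2).
Proof.
  split.
  - intros ha; exists (ip a a); apply is_series_ext with (2 := is_series_ip a a ha ha).
    intros; apply dot_Cmod.
  - intros [l hl].
    assert (H : is_lim_seq (psum a a) l).
    { apply (is_series_ext _ (fun n => dot (a n) (a n))) in hl; [exact hl|].
      intros; symmetry; apply dot_Cmod. }
    exists l; intros N; apply (is_lim_seq_incr_compare (psum a a) l H).
    intros n; apply psum_mono; lia.
Qed.

Lemma l2_powers z : Cmod z < 1 -> l2 (powers z).
Proof.
  intros hz; apply l2_ex_series.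
  apply ex_series_ext with (fun n => (Cmod z ^ 2) ^ n).
  - intros n; unfold powers; rewrite Cmod_pow, <- !pow_mult; f_equal; lia.
  - pose proof (Cmod_ge_0 z); apply ex_series_geom; rewrite Rabs_pos_eq by nra; nra.
Qed.

Lemma l2_powers_disc (z : unit_disc) : l2 (powers (Cconj z)).
Proof. apply l2_powers; rewrite Cmod_conj; exact (proj2_sig z). Qed.
#[local] Hint Resolve l2_powers_disc : l2.

Lemma is_series_C_unique (u : nat -> C) (s s' : C) :
  @is_series C_AbsRing C_NormedModule u s -> @is_series C_AbsRing C_NormedModule u s' -> s = s'.
Proof. intros h h'; transitivity (CSeries u); [symmetry|]; now apply CSeries_eq. Qed.

(** The reproducing property: [powers (Cconj z)] is the coefficient sequence of the Szego kernel at
    [z]. *)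
Lemma is_pseries_cinner a (z : unit_disc) : l2 a ->
  @is_pseries C_AbsRing C_NormedModule a (z : C) (cinner a (powers (Cconj z))).
Proof.
  intros ha.
  apply is_series_ext with (2 := is_series_cinner a _ ha (l2_powers_disc z)).
  intros n; unfold powers; rewrite Cpow_conj, Cconj_conj.
  transitivity (Cmult (Cpow z n) (a n)); [apply Cmult_comm | reflexivity].
Qed.

Lemma has_coefs_iff f a : l2 a ->
  (has_coefs f a <-> forall z : unit_disc, f z = cinner a (powers (Cconj z))).
Proof.
  intros ha; split; intros h z.
  - exact (is_series_C_unique _ _ _ (h z) (is_pseries_cinner a z ha)).
  - rewrite h; now apply is_pseries_cinner.
Qed.

Definition of_coefs (a : nat -> C) : unit_disc -> C :=
  fun z => cinner a (powers (Cconj z)).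

Lemma has_coefs_of_coefs a : l2 a -> has_coefs (of_coefs a) a.
Proof. intros ha; now apply has_coefs_iff. Qed.

Lemma has_coefs_inj f g a : has_coefs f a -> has_coefs g a -> f = g.
Proof.
  intros hf hg; apply functional_extensionality; intros z.
  exact (is_series_C_unique _ _ _ (hf z) (hg z)).
Qed.

Lemma has_coefs_add f g a b : has_coefs f a -> has_coefs g b ->
  has_coefs (fun z => Cplus (f z) (g z)) (vadd a b).
Proof.
  intros hf hg z.
  apply is_series_ext with (2 := is_series_plus _ _ _ _ (hf z) (hg z)).
  intros n; symmetry; apply (@scal_distr_l C_Ring C_ModuleSpace).
Qed.

Lemma has_coefs_scale c f a : has_coefs f a -> has_coefs (fun z => Cmult c (f z)) (vscale c a).
Proof.
  intros hf z.
  apply is_series_ext with (2 := is_series_scal_l c _ _ (hf z)).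
  intros n; change (Cmult c (Cmult (pow_n (z : C) n) (a n))
                    = Cmult (pow_n (z : C) n) (Cmult c (a n))); ring.
Qed.

Lemma has_coefs_sub f g a b : has_coefs f a -> has_coefs g b ->
  has_coefs (fun z => Cminus (f z) (g z)) (vsub a b).
Proof.
  intros hf hg.
  replace (fun z => Cminus (f z) (g z)) with (fun z => Cplus (f z) (Cmult (RtoC (-1)) (g z))).
  - apply has_coefs_add; [|apply has_coefs_scale]; assumption.
  - apply functional_extensionality; intros z.
    apply injective_projections; simpl; ring.
Qed.

Lemma H2_iff f : H2 f <-> exists a, has_coefs f a /\ l2 a.
Proof.
  split; intros (a & h1 & h2); exists a; split; try assumption; now apply l2_ex_series.
Qed.

Lemma H2_l2 f a : H2 f -> has_coefs f a -> l2 a.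
Proof.
  intros hf ha; apply H2_iff in hf; destruct hf as (b & hb & lb).
  replace a with b; [exact lb|].
  apply functional_extensionality; exact (has_coefs_unique f b a hb ha).
Qed.

Lemma inner_cinner f g a b : has_coefs f a -> has_coefs g b -> l2 a -> l2 b ->
  inner f g = cinner a b.
Proof.
  intros hf hg ha hb; apply CSeries_eq.
  apply is_series_ext with (2 := is_series_cinner a b ha hb).
  intros n; now rewrite (coef_eq f a hf), (coef_eq g b hg).
Qed.

(** * Transfer of subspaces and orthogonality to coefficients *)

Definition coef_space (M : (unit_disc -> C) -> Prop) (a : nat -> C) : Prop :=
  exists f, M f /\ has_coefs f a.

Lemma coef_space_iff M f a : has_coefs f a -> (M f <-> coef_space M a).
Proof.
  intros hf; split.
  - now exists f.
  - intros (g & Mg & hg); now rewrite (has_coefs_inj f g a).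
Qed.

Lemma closed_coef_space M : is_closed_subspace M -> closed_sub (coef_space M).
Proof.
  intros (MH2 & M0 & Madd & Mscale & Mcl).
  assert (Ml2 : forall a, coef_space M a -> l2 a).
  { intros a (f & Mf & hf); exact (H2_l2 f a (MH2 f Mf) hf). }
  split; [exact Ml2|]; split; [|split; [|split]].
  - exists (fun _ => RtoC 0); split; [exact M0|].
    pose proof (has_coefs_scale (RtoC 0) _ _ (has_coefs_of_coefs vzero l2_zero)) as h.
    replace (vscale (RtoC 0) vzero) with vzero in h by vext.
    intros z; specialize (h z); cbv beta in h; now rewrite Cmult_0_l in h.
  - intros a b (f & Mf & hf) (g & Mg & hg); eexists; split; [exact (Madd f g Mf Mg)|].
    now apply has_coefs_add.
  - intros c a (f & Mf & hf); eexists; split; [exact (Mscale c f Mf)|].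
    now apply has_coefs_scale.
  - intros x hx h; pose proof (has_coefs_of_coefs x hx) as hf.
    exists (of_coefs x); split; [|exact hf].
    apply Mcl; [apply H2_iff; now exists x|].
    intros eps heps; destruct (h (eps ^ 2) ltac:(nra)) as (p & Lp & hp).
    pose proof (Ml2 p Lp) as lp; destruct Lp as (g & Mg & hg).
    exists g; split; [exact Mg|].
    pose proof (has_coefs_sub _ _ _ _ hf hg) as hs.
    unfold H2norm; rewrite (inner_cinner _ _ _ _ hs hs) by auto with l2.
    unfold cinner, Re; simpl fst.
    rewrite <- (sqrt_pow2 eps) by lra.
    apply sqrt_lt_1_alt; split; [apply ip_pos; auto with l2 | exact hp].
Qed.

(** The real pairing suffices because the subspace is stable under multiplication by [Ci], which
    exchanges real and imaginary parts of the inner product up to sign. *)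
Lemma orthocompl_iff M g c : is_closed_subspace M -> has_coefs g c -> l2 c ->
  (orthocompl M g <-> forall a, coef_space M a -> ip a c = 0).
Proof.
  intros hM hg hc; pose proof (closed_coef_space M hM) as hL; split.
  - intros [_ h] a La; pose proof (closed_sub_l2 _ _ hL La) as la.
    destruct La as (f & Mf & hf); specialize (h f Mf).
    rewrite (inner_cinner f g a c hf hg la hc) in h; now injection h.
  - intros h; split; [apply H2_iff; now exists c|]; intros f Mf.
    destruct (proj1 (H2_iff f) (proj1 hM f Mf)) as (a & hf & la).
    assert (La : coef_space M a) by now exists f.
    rewrite (inner_cinner f g a c hf hg la hc); unfold cinner.
    rewrite h by exact La.
    rewrite <- (Ropp_involutive (ip a (vscale Ci c))), <- ip_Ci by assumption.
    rewrite h by now apply closed_sub_scale.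
    now rewrite Ropp_0.
Qed.

(** * The two operators on coefficients *)

Lemma has_coefs_cesaro f a : has_coefs f a -> l2 a -> has_coefs (cesaro f) (resolvent 1 a).
Proof.
  intros hf ha; assert (hr : l2 (resolvent 1 a)) by (apply l2_resolvent; [lra | assumption]).
  apply has_coefs_iff; [exact hr|]; intros z; apply CSeries_eq.
  apply is_series_ext with (2 := is_series_cinner _ _ hr (l2_powers_disc z)).
  intros n; unfold powers; rewrite Cpow_conj, Cconj_conj, resolvent_cesaro.
  do 2 f_equal; apply sum_n_ext; intros k; symmetry; now apply coef_eq.
Qed.

Lemma euler_powers al be z :
  euler al be (powers z) = powers (Cplus (RtoC al) (Cmult (RtoC be) z)).
Proof.
  apply functional_extensionality; intros n; unfold euler.
  (* The scalar [c] is needed for the induction: shifting a geometric sequence multiplies it by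
     [z]. *)
  enough (H : forall c, eul al be n (vscale c (powers z))
    = Cmult c (powers (Cplus (RtoC al) (Cmult (RtoC be) z)) n)).
  { specialize (H (RtoC 1)); rewrite eul_scale, !Cmult_1_l in H; exact H. }
  induction n as [|n IH]; intros c; [unfold vscale, powers; simpl; ring|].
  simpl eul.
  replace (shift (vscale c (powers z))) with (vscale (Cmult c z) (powers z)).
  - rewrite !IH; unfold powers; simpl; ring.
  - apply functional_extensionality; intros k; unfold shift, vscale, powers; simpl; ring.
Qed.

Lemma euler_adjoint r : 0 < r <= 1 ->
  (forall c, l2 c -> l2 (adjoint (euler (1 - r) r) c)) /\
  (forall b c, l2 b -> l2 c -> ip (euler (1 - r) r b) c = ip b (adjoint (euler (1 - r) r) c)).
Proof.
  intros hr; assert (0 <= / r) by (left; apply Rinv_0_lt_compat; lra).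
  assert (H1 : forall a N, psum (euler (1 - r) r a) (euler (1 - r) r a) N <= / r * psum a a N)
    by (intros; now apply euler_sq_bound).
  split; intros; [apply l2_adjoint with (/ r) | apply ip_adjoint with (/ r)];
    auto using euler_add, euler_scale.
Qed.

Lemma exp_opp_range t : 0 <= t -> 0 < exp (- t) <= 1.
Proof.
  intros ht; split; [apply exp_pos|].
  rewrite <- exp_0; destruct ht as [ht | <-]; [left; apply exp_increasing; lra|].
  rewrite Ropp_0; lra.
Qed.

(** Evaluating [g] at [phi t ht z] pairs [c] with the kernel at that point. As the map is affine
    with real coefficients, this kernel is the image under [euler] of the kernel at [z], and the
    matrix moves to [c] as its adjoint. *)
Lemma has_coefs_comp t (ht : 0 <= t) g c : has_coefs g c -> l2 c ->
  has_coefs (comp_op (phi t ht) g) (adjoint (euler (1 - exp (- t)) (exp (- t))) c).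
Proof.
  intros hg hc.
  pose proof (exp_opp_range t ht) as hr.
  destruct (euler_adjoint _ hr) as [h1 h2].
  apply has_coefs_iff; [now apply h1|]; intros z.
  unfold comp_op; rewrite (proj1 (has_coefs_iff g c hc) hg).
  assert (E : powers (Cconj (phi t ht z))
              = euler (1 - exp (- t)) (exp (- t)) (powers (Cconj z))).
  { rewrite euler_powers; f_equal; simpl; unfold phi_val.
    apply injective_projections; simpl; ring. }
  rewrite E; unfold cinner; rewrite <- euler_scale.
  rewrite !(ip_sym c), !h2 by auto with l2.
  now rewrite !(ip_sym (adjoint _ _)).
Qed.

Theorem theorem2p1 (M : (unit_disc -> C) -> Prop) (hM : is_closed_subspace M) :
  invariant M cesaro <->
  (forall (t : R) (ht : 0 <= t), invariant (orthocompl M) (comp_op (phi t ht))).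
Proof.
  pose proof (closed_coef_space M hM) as hL; split.
  - intros hC t ht g hg.
    pose proof (exp_opp_range t ht) as hr.
    destruct (proj1 (H2_iff g) (proj1 hg)) as (c & gc & lc).
    destruct (euler_adjoint _ hr) as [h1 h2].
    apply (orthocompl_iff M _ _ hM (has_coefs_comp t ht g c gc lc) (h1 c lc)); intros a La.
    (* The adjoint is moved back onto [a], whose image stays in the coefficient space of [M]. *)
    rewrite <- h2 by eauto using closed_sub_l2.
    apply (orthocompl_iff M g c hM gc lc); [exact hg|].
    apply euler_invariant; try assumption.
    intros b Lb; pose proof (closed_sub_l2 _ _ hL Lb) as lb; destruct Lb as (f & Mf & hf).
    exists (cesaro f); split; [now apply hC | now apply has_coefs_cesaro].
  - intros hS f Mf; destruct (proj1 (H2_iff f) (proj1 hM f Mf)) as (b & hf & lb).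
    apply (coef_space_iff M _ _ (has_coefs_cesaro f b hf lb)).
    apply resolvent_1_invariant; [exact hL| |now exists f].
    intros r a hr La; pose proof (closed_sub_l2 _ _ hL La) as la.
    destruct (euler_adjoint r hr) as [h1 h2].
    pose proof (l2_euler r a hr la) as le.
    (* The residual [q] gives a function in the orthogonal complement of [M], and so does its image
       under the adjoint; hence [<q,q> = <S_r a, q> = <a, S_r^* q> = 0]. *)
    destruct (orthogonal_decomposition _ _ hL le) as (p & q & Lp & lq & hort & E).
    enough (hq : ip q q <= 0).
    { rewrite E, (ip_zero_eq q lq hq); replace (vadd p vzero) with p by vext; exact Lp. }
    assert (Eq : ip (euler (1 - r) r a) q = ip q q).
    { rewrite E, ip_add_l, (hort p Lp) by eauto using closed_sub_l2.
      ring. }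
    rewrite <- Eq, h2 by assumption.
    set (t := - ln r).
    assert (ht : 0 <= t).
    { unfold t; rewrite <- ln_1; destruct (Req_dec r 1) as [->|ne]; [rewrite ln_1; lra|].
      pose proof (ln_increasing r 1 ltac:(lra) ltac:(lra)); rewrite ln_1 in *; lra. }
    assert (er : exp (- t) = r) by (unfold t; rewrite Ropp_involutive; apply exp_ln; lra).
    pose proof (has_coefs_of_coefs q lq) as hg.
    assert (Og : orthocompl M (of_coefs q)) by (now apply (orthocompl_iff M _ q hM hg lq)).
    pose proof (has_coefs_comp t ht _ _ hg lq) as hc; rewrite er in hc.
    right; exact (proj1 (orthocompl_iff M _ _ hM hc (h1 q lq)) (hS t ht _ Og) a La).
Qed.
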